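(* Let $a<b$ be real numbers, let $r\ge 1$ be an integer, and for each integer $n\ge r$ let $d_n$ denote the smallest constant for which there exists an $n$-dimensional subspace $X_n$ of $L^2(a,b)$ such that $$\min_{v\in X_n}\|u-v\|\le d_n\,\|u^{(r)}\|\qquad\text{for all } u\in H^r(a,b).$$ Then for all $n\ge r$, $$\frac{(n-r+1)\pi}{b-a}\le d_n^{-1/r}\le \frac{n\pi}{b-a}.$$
   Context: $\|\cdot\|$ denotes the $L^2(a,b)$ norm. $H^r(a,b)$ is the Sobolev space of functions in $L^2(a,b)$ whose weak derivatives up to order $r$ lie in $L^2(a,b)$, and $u^{(r)}$ is the $r$-th weak derivative of $u$. The quantity $d_n$ depends on $r$, $a$ and $b$; it is the $L^2$ $n$-width of the functions in $H^r(a,b)$ with $\|u^{(r)}\|\le 1$. *)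

(* Defs.v *)
From mathcomp Require Import all_boot all_order all_algebra.
From mathcomp Require Import all_classical all_reals all_analysis.

Set Implicit Arguments.
Unset Strict Implicit.
Unset Printing Implicit Defensive.
Import Order.TTheory GRing.Theory Num.Theory.
Import numFieldNormedType.Exports.

Local Open Scope classical_set_scope.
Local Open Scope ring_scope.

(* MathComp-Analysis. Functions on (a,b) are represented by total functions
   R -> R, looked at through the restriction of the Lebesgue measure to ]a, b[,
   so their values off ]a, b[ are irrelevant; elements of L^2(a,b) are
   represented by functions, and the identification of a.e. equal functions is
   made explicit where it matters (linear independence and subspaces). *)

Definition is_least {R : realType} (S : set R) (m : R) : Prop :=
  S m /\ lbound S m.

Definition leb_itv {R : realType} (a b : R) : {measure set (measurableTypeR R) -> \bar R} :=
  mrestr (@lebesgue_measure R) (measurable_itv `]a, b[).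

Definition L2 {R : realType} (a b : R) : set (R -> R) :=
  [set f | f \in Lfun (leb_itv a b) 2%:E].

Definition L2norm {R : realType} (a b : R) (f : R -> R) : R :=
  fine ('N[leb_itv a b]_(2%:E) [EFin \o f])%E.

(* C_c^oo(a,b) *)
Definition test_function {R : realType} (a b : R) (phi : R -> R) : Prop :=
  [/\ forall k x, derivable (derive1n k phi) x 1,
      compact (closure [set x | phi x != 0])
    & closure [set x | phi x != 0] `<=` `]a, b[].

(* For u, g in L^2(a,b) both integrands below are integrable. *)
Definition weak_derivative {R : realType} (a b : R) (k : nat) (u g : R -> R)
    : Prop :=
  forall phi : R -> R, test_function a b phi ->
    \int[leb_itv a b]_x (u x * derive1n k phi x) =
    (-1) ^+ k * \int[leb_itv a b]_x (g x * phi x).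

Definition sobolevH {R : realType} (r : nat) (a b : R) : set (R -> R) :=
  [set u | L2 a b u /\
    forall k, (k <= r)%N -> exists2 g, L2 a b g & weak_derivative a b k u g].

(* X is a subset of L^2(a,b) saturated for a.e. equality, and its image in the
   quotient has a basis of n elements. *)
Definition L2_subspace {R : realType} (a b : R) (n : nat) (X : set (R -> R))
    : Prop :=
  exists e : 'I_n -> R -> R,
    [/\ forall i, L2 a b (e i),
        forall c : 'I_n -> R,
          \sum_i c i *: e i = 0 %[ae leb_itv a b] -> forall i, c i = 0
      & X = [set v | L2 a b v /\ exists c : 'I_n -> R,
               v = \sum_i c i *: e i %[ae leb_itv a b]]].

(* The constants c for which some n-dimensional X_n satisfies
   min_{v in X_n} ||u - v|| <= c ||u^(r)|| for all u in H^r(a,b). Here g ranges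
   over the representatives of u^(r), which is unique up to a.e. equality. *)
Definition width_constants {R : realType} (a b : R) (r n : nat) : set R :=
  [set c | exists2 X : set (R -> R), L2_subspace a b n X &
    forall u g : R -> R, sobolevH r a b u ->
      L2 a b g -> weak_derivative a b r u g ->
      exists2 m, is_least [set L2norm a b (u - v) | v in X] m &
                 m <= c * L2norm a b g].

(* Main.v *)
(** A function of H^r(a,b) is, almost everywhere, the sum of a polynomial of
    degree less than r and of the r-fold primitive K^r g of its r-th weak
    derivative g (du Bois-Reymond's lemma).

    Lower bound for d_n: a nonzero combination of the n + 1 functions
    cos (k pi (x - a) / (b - a)), k <= n, is orthogonal to X_n, and its r-th
    derivative is at most (n pi / (b - a))^r times as large.

    Upper bound: let m = n - r + 1 and let X_n be spanned by the polynomials of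
    degree less than r and by the sines (if r is even) or cosines (if r is odd)
    of frequency k pi / (b - a), 0 < k < m. The iterated primitives K^j y of
    y = u - v, where v is the projection of u, vanish at both endpoints for
    0 < j <= r and stay orthogonal to the sines or to the cosines, so Wirtinger's
    inequality gives |K^(j+1) y| <= ((b - a) / (m pi)) |K^j y|; and
    |y|^2 = <K^r g, y> = +- <g, K^r y>.

    The infimum of the admissible constants is attained because every X_n can be
    replaced, without increasing its constant, by the span of the polynomials and
    of the r-fold primitives of n - r orthonormal functions, and these primitives
    form a relatively compact set. *)
Require Import Defs.
From mathcomp Require Import all_boot all_order all_algebra.
From mathcomp Require Import all_classical all_reals all_analysis.
From mathcomp Require Import measurable_realfun zify lra ring.

Set Implicit Arguments.
Unset Strict Implicit.
Unset Printing Implicit Defensive.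
Import Order.TTheory GRing.Theory Num.Theory.
Import numFieldNormedType.Exports.

Local Open Scope classical_set_scope.
Local Open Scope ring_scope.

(** Elements of H^r are known only up to null sets, whereas the argument needs endpoint values and
    pointwise derivatives. The operator K ([prim]) bridges the two: it is an inner product with an
    indicator function, hence insensitive to null sets, and it yields continuous functions on the
    whole line. Once u is described through K, two rules carry the computations: integration by
    parts for K, by Fubini, and the fundamental theorem for continuous functions. Wirtinger's
    inequality is proved without completeness of the sines or cosines: a Riccati comparison gives
    the sharp inequality on a piece with a zero at one end, and a dimension count supplies a
    function with enough zeros. The gap between the two bounds is a matter of counting. Against X_n
    the frequencies 0 to n are available, so the worst is n. In the upper bound r of the n
    dimensions go to the polynomials, which already contain the cosine of frequency 0, and the
    others to the frequencies 1 to n - r; the first one left out is n - r + 1. *)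

Section Measure.
Context {R : realType}.
Implicit Types (a b : R) (f g : R -> R).

Lemma lebesgue_itv_lty a b : (@lebesgue_measure R `]a, b[%classic < +oo)%E.
Proof. by rewrite lebesgue_measure_itv/=; case: ifP => // _; rewrite ltry. Qed.

(* The measure of [Defs], repackaged so that its finiteness is inferred. *)
Definition fin_leb_itv a b : {finite_measure set (measurableTypeR R) -> \bar R} :=
  @mfrestr _ (measurableTypeR R) R `]a, b[%classic (@lebesgue_measure R)
    (measurable_itv `]a, b[) (lebesgue_itv_lty a b).

Lemma leb_itv_off a b : leb_itv a b (~` `]a, b[) = 0%E.
Proof. by rewrite /leb_itv/= /mrestr setICl measure0. Qed.

Lemma ae_itv a b (P : R -> Prop) :
  (forall x, a < x < b -> P x) -> \forall x \ae leb_itv a b, P x.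
Proof.
move=> h; exists (~` `]a, b[); split.
- exact/measurableC.
- exact: leb_itv_off.
- by move=> x /= nP xab; apply: nP; apply: h; move: xab; rewrite in_itv.
Qed.

Lemma L2P a b f : L2 a b f <-> measurable_fun setT f /\
  (leb_itv a b).-integrable setT (EFin \o (fun x => f x ^+ 2)).
Proof.
split=> [/=lf|[mf fi]].
  split; last exact: Lfun2_integrable_sqr.
  by have /set_mem := sub_Lfun_mfun lf.
rewrite /L2 /= inE; apply/andP; split; rewrite inE//=.
rewrite /finite_norm unlock /=.
apply: poweR_lty.
have /integrableP[_] := fi.
apply: le_lt_trans; rewrite le_eqVlt; apply/orP; left; apply/eqP.
apply: eq_integral => x _ /=.
by rewrite normrX powR_mulrn.
Qed.

Lemma L2_measurable a b f : L2 a b f -> measurable_fun setT f.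
Proof. by case/L2P. Qed.

Lemma L2_mul_integrable a b f g : L2 a b f -> L2 a b g ->
  (leb_itv a b).-integrable setT (EFin \o (fun x => f x * g x)).
Proof. by move=> lf lg; apply/Lfun1_integrable; exact: Lfun2_mul_Lfun1. Qed.

Lemma L2_submod_closed a b : submod_closed (Lfun (leb_itv a b) 2%:E).
Proof. by apply: Lfun_submod_closed; rewrite lee1n. Qed.

Lemma L2D a b f g : L2 a b f -> L2 a b g -> L2 a b (f + g).
Proof.
have [_ h] := L2_submod_closed a b.
by move=> lf lg; have := h 1 _ _ lf lg; rewrite scale1r.
Qed.

Lemma L2Z a b (c : R) f : L2 a b f -> L2 a b (c *: f).
Proof.
have [h0 h] := L2_submod_closed a b.
by move=> lf; have := h c _ _ lf h0; rewrite addr0.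
Qed.

Lemma L2B a b f g : L2 a b f -> L2 a b g -> L2 a b (f - g).
Proof. by move=> lf lg; rewrite -scaleN1r; apply/L2D/L2Z. Qed.

Lemma L2_sum a b n (c : 'I_n -> R) (e : 'I_n -> R -> R) :
  (forall i, L2 a b (e i)) -> L2 a b (\sum_i c i *: e i).
Proof.
move=> le; elim/big_ind: _ => [|f g|i _]; [|exact: L2D|exact/L2Z/le].
by have [] := L2_submod_closed a b.
Qed.

(** The bound holds only on ]a, b[, so the null complement is discarded first; a constant is then
    integrable because the measure is finite. *)
Lemma L2_bounded a b f (M : R) : measurable_fun setT f ->
  (forall x, a < x < b -> `|f x| <= M) -> L2 a b f.
Proof.
move=> mf fM; apply/L2P; split => //.
have mf2 : measurable_fun setT (EFin \o (fun x => f x ^+ 2)).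
  by apply/measurable_EFinP; exact: measurable_funX.
have mo : measurable (~` `]a, b[%classic : set (measurableTypeR R)).
  exact: measurableC.
apply/(negligible_integrable mo measurableT mf2); first exact: leb_itv_off.
rewrite setTD setCK.
apply: (@le_integrable _ _ _ _ _ _ _ (EFin \o cst (M ^+ 2))).
- exact: measurable_itv.
- exact: measurable_funTS.
- move=> x /=; rewrite in_itv/= => xab; rewrite lee_fin normrX.
  have M0 : 0 <= M by apply: le_trans (fM x xab).
  by rewrite /= (ger0_norm (exprn_ge0 _ M0)) ler_pXn2r ?nnegrE//; exact: fM.
- have := @finite_measure_integrable_cst _ _ _ (fin_leb_itv a b) `]a, b[%classic (M ^+ 2).
  by apply; exact: measurable_itv.
Qed.

Lemma L2_continuous a b f : continuous f -> L2 a b f.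
Proof.
move=> cf; have [ab|ba] := ltP a b; last first.
  apply: (@L2_bounded _ _ _ 0); first exact: continuous_measurable_fun.
  by move=> x /andP[ax xb]; move: ba; rewrite leNgt (lt_trans ax xb).
have cfab : {within `[a, b], continuous (fun x => `|f x|)}.
  by apply: continuous_subspaceT => x; apply: continuous_comp; [exact: cf|exact: norm_continuous].
have [c _ fc] := EVT_max (ltW ab) cfab.
apply: (@L2_bounded _ _ _ `|f c|); first exact: continuous_measurable_fun.
by move=> x /andP[ax xb]; apply: fc; rewrite in_itv/= !ltW.
Qed.

End Measure.

(** * The inner product and the norm of L^2(a, b) *)

Section InnerProduct.
Context {R : realType} (a b : R).
Implicit Types (f g h : R -> R).
Local Notation mu := (leb_itv a b).
Local Notation L2 := (L2 a b).

Definition ip f g : R := \int[mu]_x (f x * g x).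

Lemma ipC f g : ip f g = ip g f.
Proof. by apply: eq_Rintegral => x _; rewrite mulrC. Qed.

Lemma ipDl f g h : L2 f -> L2 g -> L2 h -> ip (f + g) h = ip f h + ip g h.
Proof.
move=> lf lg lh; rewrite /ip -RintegralD//; try exact: L2_mul_integrable.
by apply: eq_Rintegral => x _; rewrite -mulrDl.
Qed.

Lemma ipZl (c : R) f g : L2 f -> L2 g -> ip (c *: f) g = c * ip f g.
Proof.
move=> lf lg; rewrite /ip -RintegralZl//; last exact: L2_mul_integrable.
by apply: eq_Rintegral => x _; rewrite mulrA.
Qed.

Lemma ipNl f g : L2 f -> L2 g -> ip (- f) g = - ip f g.
Proof. by move=> lf lg; rewrite -scaleN1r ipZl// mulN1r. Qed.

Lemma L2N f : L2 f -> L2 (- f).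
Proof. by move=> lf; rewrite -scaleN1r; exact: L2Z. Qed.

Lemma ipBl f g h : L2 f -> L2 g -> L2 h -> ip (f - g) h = ip f h - ip g h.
Proof. by move=> lf lg lh; rewrite ipDl ?ipNl//; exact: L2N. Qed.

Lemma ipDr f g h : L2 f -> L2 g -> L2 h -> ip f (g + h) = ip f g + ip f h.
Proof. by move=> lf lg lh; rewrite ipC ipDl// !(ipC f). Qed.

Lemma ipZr (c : R) f g : L2 f -> L2 g -> ip f (c *: g) = c * ip f g.
Proof. by move=> lf lg; rewrite ipC ipZl// ipC. Qed.

Lemma ipBr f g h : L2 f -> L2 g -> L2 h -> ip f (g - h) = ip f g - ip f h.
Proof. by move=> lf lg lh; rewrite ipC ipBl// !(ipC f). Qed.

Lemma ip0l g : ip 0 g = 0.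
Proof.
rewrite /ip (_ : (fun x => _) = cst 0) ?Rintegral_cst ?mul0r//.
by apply/funext => x /=; rewrite mul0r.
Qed.

Lemma lincombE n (c : 'I_n -> R) (e : 'I_n -> R -> R) x :
  (\sum_i c i *: e i) x = \sum_i c i * e i x.
Proof. by elim/big_rec2: _ => // i y1 y2 _ <-. Qed.

Lemma ip_suml n (c : 'I_n -> R) (e : 'I_n -> R -> R) g :
  (forall i, L2 (e i)) -> L2 g ->
  ip (\sum_i c i *: e i) g = \sum_i c i * ip (e i) g.
Proof.
move=> le lg.
suff [] : L2 (\sum_i c i *: e i) /\
  ip (\sum_i c i *: e i) g = \sum_i c i * ip (e i) g by [].
elim/big_rec2: _ => [|i x f _ [lf fx]].
  by split; [have [] := L2_submod_closed a b|rewrite ip0l].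
by split; [apply/L2D => //; exact/L2Z|rewrite ipDl ?ipZl ?fx//; exact/L2Z].
Qed.

Lemma ip_sumr n (c : 'I_n -> R) (e : 'I_n -> R -> R) f :
  (forall i, L2 (e i)) -> L2 f ->
  ip f (\sum_i c i *: e i) = \sum_i c i * ip f (e i).
Proof.
move=> le lf; rewrite ipC ip_suml//.
by apply: eq_bigr => i _; rewrite ipC.
Qed.

Lemma ip_ge0 f : 0 <= ip f f.
Proof. by apply: Rintegral_ge0 => x _; rewrite -expr2 sqr_ge0. Qed.

Lemma ae_imply (P Q : R -> Prop) : (forall x, P x -> Q x) ->
  (\forall x \ae mu, P x) -> \forall x \ae mu, Q x.
Proof. by move=> PQ; apply: (@filterS _ _ (ae_filter_ringOfSetsType mu)). Qed.

Lemma ae_imply2 (P Q S : R -> Prop) : (forall x, P x -> Q x -> S x) ->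
  (\forall x \ae mu, P x) -> (\forall x \ae mu, Q x) -> \forall x \ae mu, S x.
Proof. by move=> PQ; apply: (@filterS2 _ _ (ae_filter_ringOfSetsType mu)). Qed.

Lemma ae_forall_ord n (P : 'I_n -> R -> Prop) :
  (forall i, \forall x \ae mu, P i x) -> \forall x \ae mu, forall i, P i x.
Proof.
move=> Pi; have : \forall x \ae mu, forall i, i \in enum 'I_n -> P i x.
  elim: (enum 'I_n) => [|i s IH].
    by apply: (@filterE _ _ (ae_filter_ringOfSetsType mu)) => x i; rewrite in_nil.
  apply: (ae_imply2 _ (Pi i) IH) => x h1 h2 j.
  by rewrite inE => /predU1P[->//|/h2].
by apply: ae_imply => x h i; apply: h; rewrite mem_enum.
Qed.

Lemma eq_ip f f' g g' : L2 f -> L2 f' -> L2 g -> L2 g' ->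
  f = f' %[ae mu] -> g = g' %[ae mu] -> ip f g = ip f' g'.
Proof.
move=> /L2_measurable mf /L2_measurable mf' /L2_measurable mg /L2_measurable mg' ff' gg'.
congr fine; apply: ae_eq_integral => //.
- by apply/measurable_EFinP; exact: measurable_funM.
- by apply/measurable_EFinP; exact: measurable_funM.
- apply: (ae_imply2 _ ff' gg') => x /= h1 h2 _; rewrite h1 // h2 //.
Qed.

Lemma ip_eq0 f : L2 f -> ip f f = 0 -> f = 0 %[ae mu].
Proof.
move=> lf ff0; have mf := L2_measurable lf.
have m2 : measurable_fun setT (fun x => (f x * f x)%:E).
  by apply/measurable_EFinP; exact: measurable_funM.
have h : (\int[mu]_x `|(f x * f x)%:E| = 0)%E.
  have := ff0; rewrite /ip /Rintegral => h.
  rewrite -[RHS]/((0 : R)%:E) -h fineK; last first.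
    exact: integrable_fin_num (L2_mul_integrable lf lf).
  by apply: eq_integral => x _; rewrite gee0_abs// lee_fin -expr2 sqr_ge0.
have := (ae_eq_integral_abs mu measurableT m2).1 h.
apply: ae_imply => x /= /(_ I)[] /eqP.
by rewrite mulf_eq0 orbb => /eqP.
Qed.

Lemma ip_ae0 f : L2 f -> f = 0 %[ae mu] -> ip f f = 0.
Proof.
move=> lf f0; have l0 : L2 0 by have [] := L2_submod_closed a b.
rewrite -[RHS](ip0l f); apply: eq_ip => //.
by apply: (ae_imply _ f0).
Qed.

Lemma L2normE f : L2 f -> L2norm a b f = Num.sqrt (ip f f).
Proof.
move=> lf; rewrite /L2norm.
have -> : ('N[mu]_(2%:E) [EFin \o f] = (\int[mu]_x (f x * f x)%:E) `^ 2^-1)%E.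
  rewrite unlock; congr (_ `^ _)%E; apply: eq_integral => x _ /=.
  by rewrite powR_mulrn ?normr_ge0// real_normK ?num_real// expr2.
rewrite -[X in (X `^ _)%E]fineK; last exact: integrable_fin_num (L2_mul_integrable lf lf).
by rewrite poweR_EFin powR12_sqrt//; exact: ip_ge0.
Qed.

Lemma L2norm_ge0 f : 0 <= L2norm a b f.
Proof. by rewrite /L2norm fine_ge0// Lnorm_ge0. Qed.

Lemma L2norm_sqr f : L2 f -> L2norm a b f ^+ 2 = ip f f.
Proof. by move=> lf; rewrite L2normE// sqr_sqrtr// ip_ge0. Qed.

Lemma cauchy_schwarz f g : L2 f -> L2 g -> ip f g ^+ 2 <= ip f f * ip g g.
Proof.
move=> lf lg.
have key (t : R) : 0 <= ip f f + 2 * t * ip f g + t ^+ 2 * ip g g.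
  have := ip_ge0 (f + t *: g).
  have ltg : L2 (t *: g) by exact: L2Z.
  rewrite ipDl ?ipDr ?ipZl ?ipZr//; try exact: L2D.
  by rewrite (ipC g f); nra.
have g0 := ip_ge0 g.
have [gg0|gn0] := eqVneq (ip g g) 0.
  rewrite gg0 mulr0; have [->|fgn0] := eqVneq (ip f g) 0; first by rewrite expr0n.
  (* With [ip g g = 0] the nonnegative expression in [key] is affine in [t]; this [t] would give it
     the value -1. *)
  have := key (- (ip f f + 1) / (2 * ip f g)).
  rewrite gg0 mulr0 addr0.
  have -> : 2 * (- (ip f f + 1) / (2 * ip f g)) * ip f g = - (ip f f + 1) by field.
  by lra.
(* The minimizer of the quadratic polynomial in [key]. *)
have := key (- ip f g / ip g g).
have gp : 0 < ip g g by rewrite lt_neqAle eq_sym gn0.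
have -> : ip f f + 2 * (- ip f g / ip g g) * ip f g + (- ip f g / ip g g) ^+ 2 * ip g g
  = (ip f f * ip g g - ip f g ^+ 2) / ip g g by field.
by rewrite pmulr_lge0 ?invr_gt0// subr_ge0.
Qed.

Lemma normr_ip_le f g : L2 f -> L2 g -> `|ip f g| <= L2norm a b f * L2norm a b g.
Proof.
move=> lf lg; rewrite -(ler_pXn2r (n := 2))// ?nnegrE ?mulr_ge0 ?L2norm_ge0//.
by rewrite exprMn !L2norm_sqr// real_normK ?num_real// cauchy_schwarz.
Qed.

Lemma L2norm_triangle f g : L2 f -> L2 g ->
  L2norm a b (f + g) <= L2norm a b f + L2norm a b g.
Proof.
move=> lf lg.
rewrite -(ler_pXn2r (n := 2))// ?nnegrE ?addr_ge0 ?L2norm_ge0//.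
rewrite sqrrD !L2norm_sqr//; last exact: L2D.
rewrite ipDl ?ipDr//; try exact: L2D.
have := normr_ip_le lf lg; rewrite (ipC g f) => h.
by have := ler_norm (ip f g); nra.
Qed.

Lemma eq_L2norm f g : L2 f -> L2 g -> f = g %[ae mu] -> L2norm a b f = L2norm a b g.
Proof. by move=> lf lg fg; rewrite !L2normE// (eq_ip lf lg lf lg). Qed.

Lemma L2norm_scale (c : R) f : L2 f -> L2norm a b (c *: f) = `|c| * L2norm a b f.
Proof.
move=> lf; rewrite !L2normE//; last exact: L2Z.
rewrite ipZl ?ipZr//; last exact: L2Z.
by rewrite mulrA -expr2 sqrtrM ?sqr_ge0// sqrtr_sqr.
Qed.

End InnerProduct.

(** * Hölder continuity and the primitive of an L^2 function *)

Lemma holder_continuous {R : realType} (f : R -> R) (B : R) :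
  (forall x y, `|f x - f y| <= B * Num.sqrt `|x - y|) -> continuous f.
Proof.
move=> fB x; apply/cvgrPdist_lt => e e0.
(* No sign is assumed on [B], and the division below asks for a positive constant. *)
have B0 : 0 < `|B| + 1 by rewrite ltr_wpDl.
have d0 : 0 < e / (`|B| + 1) by rewrite divr_gt0.
near=> y.
apply: (le_lt_trans (fB _ _)).
apply: (@le_lt_trans _ _ ((`|B| + 1) * Num.sqrt `|x - y|)).
  by rewrite ler_wpM2r ?sqrtr_ge0// (le_trans (ler_norm _))// lerDl.
rewrite mulrC -ltr_pdivlMr//.
have -> : e / (`|B| + 1) = Num.sqrt ((e / (`|B| + 1)) ^+ 2).
  by rewrite sqrtr_sqr (ger0_norm (ltW d0)).
rewrite ltr_sqrt ?exprn_gt0//.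
near: y; apply: cvgr_dist_lt; [exact: cvg_id|exact: exprn_gt0].
Unshelve. all: by end_near. Qed.

Section Primitive.
Context {R : realType} (a b : R) (ab : a < b).
Implicit Types (f g h : R -> R) (x y : R).
Local Notation mu := (leb_itv a b).
Local Notation L2 := (L2 a b).
Local Notation ip := (ip a b).

Definition below x : R -> R := fun t => (t < x)%R%:R.

Lemma below_measurable x : measurable_fun setT (below x).
Proof.
have -> : below x = \1_`]-oo, x[%classic.
  by apply/funext => t; rewrite indicE mem_setE in_itv.
by apply: measurable_indic; exact: measurable_itv.
Qed.

Lemma L2_below x : L2 (below x).
Proof.
apply: (@L2_bounded _ _ _ _ 1); first exact: below_measurable.
by move=> t _; rewrite /below; case: (_ < _)%R; rewrite ?normr1 ?normr0.
Qed.

Lemma L2_cst (c : R) : L2 (cst c).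
Proof. by apply: L2_continuous => x; exact: cst_continuous. Qed.

(* The integral of f over ]a, x[, since mu lives on ]a, b[; it is constant on
   each side of ]a, b[. *)
Definition prim f x := ip f (below x).

Lemma prim_left f x : L2 f -> x <= a -> prim f x = 0.
Proof.
move=> lf xa; rewrite /prim ipC -(ip0l a b f); apply: eq_ip => //.
- exact: L2_below.
- by have [] := L2_submod_closed a b.
- apply: ae_itv => t /andP[at_ tb] _ /=.
  by rewrite /below ltNge (le_trans xa (ltW at_)).
- by apply: ae_itv.
Qed.

Lemma prim_right f x : L2 f -> b <= x -> prim f x = ip f (cst 1).
Proof.
move=> lf bx; apply: eq_ip => //; [exact: L2_below|exact: L2_cst| |].
- by apply: ae_itv.
- apply: ae_itv => t /andP[at_ tb] _ /=.
  by rewrite /below (lt_le_trans tb bx).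
Qed.

Lemma primD f g x : L2 f -> L2 g -> prim (f + g) x = prim f x + prim g x.
Proof. by move=> lf lg; apply: ipDl => //; exact: L2_below. Qed.

Lemma primZ (c : R) f x : L2 f -> prim (c *: f) x = c * prim f x.
Proof. by move=> lf; apply: ipZl => //; exact: L2_below. Qed.

Lemma primB f g x : L2 f -> L2 g -> prim (f - g) x = prim f x - prim g x.
Proof. by move=> lf lg; apply: ipBl => //; exact: L2_below. Qed.

Lemma below_subE x y t : x <= y ->
  (below y - below x) t = (x <= t < y)%R%:R :> R.
Proof.
move=> xy; rewrite -[(below y - below x) t]/((t < y)%R%:R - (t < x)%R%:R).
case: (leP x t) => [_|tx]; first by case: (t < y)%R; rewrite subr0.
by rewrite (lt_le_trans tx xy) subrr.
Qed.

Lemma ip_belowB x y : x <= y ->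
  ip (below y - below x) (below y - below x) <= y - x.
Proof.
move=> xy; rewrite -[ip _ _]/(\int[mu]_t _).
have -> : (fun t => (below y - below x) t * (below y - below x) t) =
    \1_(`[x, y[%classic : set R).
  apply/funext => t; rewrite indicE mem_setE in_itv/= below_subE//.
  by case: (_ && _); rewrite ?mulr0 ?mulr1.
rewrite /Rintegral integral_indic//= setIT.
rewrite -lee_fin fineK; last first.
  by apply: (fin_num_measure (fin_leb_itv a b)); exact: measurable_itv.
rewrite /mrestr (@le_trans _ _ (@lebesgue_measure R `[x, y[%classic))//.
  apply: le_measure; rewrite ?inE; [|exact: measurable_itv|exact: subIsetl].
  by apply: measurableI; exact: measurable_itv.
by rewrite lebesgue_measure_itv/=; case: ifPn => //; rewrite lee_fin subr_ge0.
Qed.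

(** Cauchy-Schwarz against the indicator of [x, y[, whose norm is at most the square root of y - x.
    The same bound later provides the equicontinuity of the compactness argument. *)
Lemma prim_holder f x y : L2 f -> x <= y ->
  `|prim f y - prim f x| <= L2norm a b f * Num.sqrt (y - x).
Proof.
move=> lf xy; have lyx : L2 (below y - below x) by apply: L2B; exact: L2_below.
rewrite /prim -ipBr//; try exact: L2_below.
apply: (le_trans (normr_ip_le lf lyx)).
by rewrite ler_wpM2l ?L2norm_ge0// L2normE// ler_wsqrtr// ip_belowB.
Qed.

Lemma prim_holder_abs f x y : L2 f ->
  `|prim f x - prim f y| <= L2norm a b f * Num.sqrt `|x - y|.
Proof.
move=> lf; wlog xy : x y / y <= x.
  move=> h; have [/h//|/ltW/h] := leP y x.
  by rewrite distrC [in X in _ <= X]distrC.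
by rewrite [`|x - y|]ger0_norm ?subr_ge0//; exact: prim_holder.
Qed.

Lemma prim_continuous f : L2 f -> continuous (prim f).
Proof.
move=> lf; apply: holder_continuous => x y; exact: prim_holder_abs.
Qed.

Lemma L2_prim f : L2 f -> L2 (prim f).
Proof. by move=> lf; apply: L2_continuous; exact: prim_continuous. Qed.

End Primitive.

(** * Integration by parts for L^2 functions *)

Section FubiniPrimitive.
Context {R : realType} (a b : R) (ab : a < b).
Implicit Types (f g h : R -> R) (x y : R).
Local Notation mu := (leb_itv a b).
Local Notation L2 := (L2 a b).
Local Notation ip := (ip a b).
Local Notation prim := (prim a b).

Lemma L2_integrable f : L2 f -> mu.-integrable setT (EFin \o f).
Proof.
move=> lf; have := L2_mul_integrable lf (L2_cst a b 1).
by apply: eq_integrable => // x _ /=; rewrite mulr1.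
Qed.

Lemma atom_ae0 x : \forall t \ae mu, t != x.
Proof.
exists [set x]; split; first exact: measurable_set1.
  rewrite /leb_itv/= /mrestr; apply/eqP; rewrite eq_le measure_ge0 andbT.
  rewrite -(@lebesgue_measure_set1 R x); apply: le_measure; rewrite ?inE.
  - by apply: measurableI; [exact: measurable_set1|exact: measurable_itv].
  - exact: measurable_set1.
  - exact: subIsetl.
by move=> t /= /negP; rewrite negbK => /eqP.
Qed.

Lemma L2_above x : L2 (fun t => (x < t)%R%:R).
Proof.
apply: (@L2_bounded _ _ _ _ 1).
  have -> : (fun t => (x < t)%R%:R) = \1_`]x, +oo[%classic :> (R -> R).
    by apply/funext => t; rewrite indicE mem_setE in_itv/= andbT.
  by apply: measurable_indic; exact: measurable_itv.
by move=> t _; case: (_ < _)%R; rewrite ?normr1 ?normr0.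
Qed.

(** The complement of [t < x] is [x <= t]; the strict form, which the exchange of variables
    produces, differs from it at a single point, a null set. *)
Lemma ip_above f x : L2 f ->
  ip f (fun t => (x < t)%R%:R) = ip f (cst 1) - prim f x.
Proof.
move=> lf; rewrite -ipBr//; [|exact: L2_cst|exact: L2_below].
have l1 : L2 (cst 1 - below x) by apply: L2B; [exact: L2_cst|exact: L2_below].
apply: eq_ip => //; [|by apply: ae_itv|].
- exact: L2_above.
- apply: (ae_imply _ (atom_ae0 x)) => t tx _.
  rewrite -[(cst 1 - below x) t]/(1 - (t < x)%R%:R).
  by case: (ltgtP t x) tx; rewrite ?subrr ?subr0.
Qed.

(** Fubini over the triangle y < x: integrating f(y) g(x) first in y gives <K f, g>, and first in x
    it pairs f with the mass of g above y, that is <g, 1> - K g(y). If f or g has mean zero, K is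
    antisymmetric on the pair. *)
Lemma ip_prim f g : L2 f -> L2 g ->
  ip (prim f) g + ip f (prim g) = ip f (cst 1) * ip g (cst 1).
Proof.
move=> lf lg.
have lpf := L2_prim lf; have lpg := L2_prim lg.
have l1 := L2_cst a b 1.
suff : ip (prim f) g = ip f (ip g (cst 1) *: cst 1 - prim g).
  rewrite ipBr ?ipZr//; last exact: L2Z.
  by move=> ->; rewrite subrK mulrC.
pose m := fin_leb_itv a b.
pose T2 := (measurableTypeR R * measurableTypeR R)%type.
pose k (z : T2) : R := g z.1 * (f z.2 * (z.2 < z.1)%R%:R).
have mk : measurable_fun setT (EFin \o k).
  apply/measurable_EFinP; apply: measurable_funM.
    by apply: measurableT_comp => //; exact: L2_measurable lg.
  apply: measurable_funM.
    by apply: measurableT_comp => //; exact: L2_measurable lf.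
  have mA : measurable [set z : T2 | (z.2 < z.1)%R].
    rewrite -[X in measurable X]setTI.
    by apply: (@measurable_fun_ltr _ _ _ setT snd fst).
  have -> : (fun z : T2 => (z.2 < z.1)%R%:R) = \1_[set z : T2 | (z.2 < z.1)%R] :> (T2 -> R).
    by apply/funext => z; rewrite indicE mem_setE.
  exact: measurable_indic.
(* |k(x, y)| is at most |g(x)| |f(y)|, whose iterated integral is a product of two finite L^1
   norms. *)
have ik : (m \x m)%E.-integrable setT (EFin \o k).
  apply/(integrable12ltyP m m mk).
  have /integrableP[_ ifa] := L2_integrable lf.
  have /integrableP[_ iga] := L2_integrable lg.
  pose F : R := fine (\int[mu]_y `|(f y)%:E|)%E.
  have FE : (\int[mu]_y `|(f y)%:E| = F%:E)%E.
    by rewrite fineK// ge0_fin_numE//; exact: integral_ge0.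
  have F0 : 0 <= F by apply: fine_ge0; exact: integral_ge0.
  have mf' := L2_measurable lf; have mg' := L2_measurable lg.
  apply: (@le_lt_trans _ _ (\int[mu]_x (F%:E * `|(g x)%:E|))%E).
    apply: ge0_le_integral => //.
    - by move=> x _; exact: integral_ge0.
    - apply: (@measurable_fun_fubini_tonelli_F _ _ _ _ _ m
          (fun z => `|(EFin \o k) z|)%E) => //.
      by apply: measurableT_comp.
    - apply: emeasurable_funM => //; apply: measurableT_comp => //.
      exact/measurable_EFinP.
    - move=> x _; rewrite muleC -FE -ge0_integralZl//; last first.
        by apply: measurableT_comp => //; exact/measurable_EFinP.
      apply: ge0_le_integral => //.
      + apply: measurableT_comp => //.
        exact: (measurableT_comp mk (pair1_measurable x)).
      + apply: emeasurable_funM => //; apply: measurableT_comp => //.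
        exact/measurable_EFinP.
      + move=> y _; rewrite /k/= -EFinM lee_fin !normrM ler_wpM2l//.
        by case: (y < x)%R; rewrite ?normr1 ?normr0 ?mulr1 ?mulr0.
  have mga : measurable_fun setT (fun x => `|(g x)%:E|)%E.
    by apply: measurableT_comp => //; exact/measurable_EFinP.
  rewrite (ge0_integralZl mu measurableT mga)//.
  by rewrite lte_mul_pinfty// lee_fin.
have := Fubini ik.
have -> : (\int[m]_x \int[m]_y (EFin \o k) (x, y) = \int[mu]_x (g x * prim f x)%:E)%E.
  apply: eq_integral => x _ /=.
  have lfx := L2_mul_integrable lf (L2_below a b x).
  rewrite /k/= (EFinM (g x)) -[prim f x]/(fine _) fineK; last exact: integrable_fin_num.
  by rewrite -integralZl//; apply: eq_integral => y _; rewrite /= EFinM.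
have -> : (\int[m]_y \int[m]_x (EFin \o k) (x, y) =
    \int[mu]_y (f y * (ip g (cst 1) - prim g y))%:E)%E.
  apply: eq_integral => y _ /=.
  have lgy := L2_mul_integrable lg (L2_above y).
  rewrite -ip_above// (EFinM (f y)) -[ip _ _]/(fine _) fineK; last exact: integrable_fin_num.
  rewrite -integralZl//; apply: eq_integral => x _; rewrite /= /k /=.
  by rewrite -EFinM mulrCA.
move=> e; rewrite ipC -[LHS]/(fine _) -[RHS]/(fine _) e; congr fine.
apply: eq_integral => y _ /=; congr (f y * _)%:E.
by rewrite -[(_ - _) y]/(ip g (cst 1) * 1 - prim g y) mulr1.
Qed.

End FubiniPrimitive.

(** * The derivative of a primitive *)

Section Calculus.
Context {R : realType} (a b : R) (ab : a < b).
Implicit Types (f g h v w : R -> R) (x y c d : R).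
Local Notation mu := (leb_itv a b).
Local Notation L2 := (L2 a b).
Local Notation ip := (ip a b).
Local Notation prim := (prim a b).

Lemma ip_ge0_itv f g : L2 f -> L2 g ->
  (forall x, a < x < b -> 0 <= f x * g x) -> 0 <= ip f g.
Proof.
move=> lf lg fg.
have mfg : measurable_fun setT (f * g).
  by apply: measurable_funM; [exact: L2_measurable lf|exact: L2_measurable lg].
have -> : ip f g = \int[mu]_x `|f x * g x|.
  congr fine; apply: ae_eq_integral => //.
  - exact/measurable_EFinP.
  - by apply/measurable_EFinP; exact: measurableT_comp.
  - by apply: ae_itv => x /fg fgx _; rewrite ger0_norm.
by apply: Rintegral_ge0.
Qed.

Lemma ip_le_itv f g h : L2 f -> L2 g -> L2 h ->
  (forall x, a < x < b -> f x * h x <= g x * h x) -> ip f h <= ip g h.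
Proof.
move=> lf lg lh fg; rewrite -subr_ge0 -ipBl//; apply: ip_ge0_itv => //.
  exact: L2B.
by move=> x /fg; rewrite -[(g - f) x]/(g x - f x) mulrBl subr_ge0.
Qed.

Lemma ip_cst1_belowB x y : a <= x -> x <= y -> y <= b ->
  ip (cst 1) (below y - below x) = y - x.
Proof.
move=> ax xy yb; rewrite -[ip _ _]/(\int[mu]_t _).
have -> : (fun t => cst 1 t * (below y - below x) t) =
    \1_(`[x, y[%classic : set R).
  by apply/funext => t; rewrite indicE mem_setE in_itv/= mul1r below_subE.
rewrite /Rintegral integral_indic// setIT.
suff -> : mu `[x, y[%classic = (y - x)%:E by [].
rewrite /leb_itv/= /mrestr.
transitivity (@lebesgue_measure R `]x, y[%classic).
  apply/eqP; rewrite eq_le; apply/andP; split; last first.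
    apply: le_measure; rewrite ?inE.
    - exact: measurable_itv.
    - by apply: measurableI; exact: measurable_itv.
    - move=> t /=; rewrite !in_itv/= => /andP[xt ty].
      by rewrite (ltW xt) ty (le_lt_trans ax xt) (lt_le_trans ty yb).
  apply: (@le_trans _ _ (@lebesgue_measure R `[x, y[%classic)).
    apply: le_measure; rewrite ?inE; [|exact: measurable_itv|exact: subIsetl].
    by apply: measurableI; exact: measurable_itv.
  by rewrite !lebesgue_measure_itv.
rewrite lebesgue_measure_itv/= lte_fin.
case: ltP => // yx; suff -> : x = y by rewrite subrr.
by apply/eqP; rewrite eq_le xy yx.
Qed.

Lemma prim_mean f x y (m : R) : L2 f -> a <= x -> x <= y -> y <= b ->
  (forall t, x <= t <= y -> f t <= m) -> prim f y - prim f x <= m * (y - x).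
Proof.
move=> lf ax xy yb fm.
have lyx : L2 (below y - below x) by apply: L2B; exact: L2_below.
rewrite -[prim f y]/(ip _ _) -[prim f x]/(ip _ _) -ipBr//; try exact: L2_below.
rewrite -(ip_cst1_belowB ax xy yb) -ipZl//; last exact: L2_cst.
apply: ip_le_itv => //; first exact/L2Z/L2_cst.
move=> t _; rewrite below_subE//.
have -> : (m *: cst 1) t = m :> R by rewrite -[LHS]/(m * 1) mulr1.
case: (boolP (x <= t < y)) => [/andP[xt ty]|_]; last by rewrite !mulr0.
by rewrite !mulr1 fm// xt ltW.
Qed.

Lemma prim_approx f x y (k e : R) : L2 f -> a <= x -> x <= y -> y <= b ->
  (forall t, x <= t <= y -> `|k - f t| <= e) ->
  `|k * (y - x) - (prim f y - prim f x)| <= e * (y - x).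
Proof.
move=> lf ax xy yb fk; have lNf : L2 (- f) by exact: L2N.
have u1 : prim f y - prim f x <= (k + e) * (y - x).
  by apply: prim_mean => // t /fk; rewrite ler_norml; lra.
have u2 : prim (- f) y - prim (- f) x <= (e - k) * (y - x).
  apply: prim_mean => // t /fk; rewrite ler_norml -[(- f) t]/(- f t); lra.
have primN z : prim (- f) z = - prim f z by rewrite -scaleN1r primZ// mulN1r.
by move: u2; rewrite !primN ler_norml; lra.
Qed.

(** Near x the function f stays within e of f(x); [prim_approx] integrates this between x and x + h,
    and division by |h| bounds the error of the difference quotient by e. *)
Lemma is_derive_prim f x : L2 f -> {for x, continuous f} -> a < x < b ->
  is_derive x 1 (prim f) (f x).
Proof.
move=> lf cfx /andP[ax xb].
suff h : (fun h : R => h^-1 *: (prim f (h + x) - prim f x)) @ (0 : R)^' --> f x.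
  have h' : (fun h : R => h^-1 *: (prim f (h *: (1 : R) + x) - prim f x)) @ (0 : R)^' --> f x.
    by under eq_fun do rewrite [_ *: 1]mulr1.
  apply: DeriveDef; first by apply/cvg_ex; exists (f x).
  exact: cvg_lim h'.
apply/cvgrPdist_le => e e0.
have /cvgrPdist_le /(_ e e0) := cfx; rewrite near_nbhs => /nbhs_ballP[d /= d0 fd].
have xa0 : 0 < x - a by rewrite subr_gt0.
have bx0 : 0 < b - x by rewrite subr_gt0.
near=> h.
have h0 : h != 0 by near: h; exact: nbhs_dnbhs_neq.
have hd : `|h| < d by near: h; exact: dnbhs0_lt.
have hxa : `|h| < x - a by near: h; exact: dnbhs0_lt.
have hbx : `|h| < b - x by near: h; exact: dnbhs0_lt.
have {}fd t : `|x - t| <= `|h| -> `|f x - f t| <= e.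
  by move=> xt; apply: fd; rewrite /ball/=; exact: le_lt_trans hd.
have key : `|f x * h - (prim f (h + x) - prim f x)| <= e * `|h|.
  move: hxa hbx; rewrite !ltr_norml => hxa hbx.
  have [hp|hn] := ltP 0 h.
    have := @prim_approx f x (h + x) (f x) e lf (ltW ax).
    rewrite addrK (gtr0_norm hp); apply; [lra|lra|] => t xt.
    by apply: fd; rewrite (gtr0_norm hp) ler_norml; lra.
  have := @prim_approx f (h + x) x (f x) e lf.
  move=> H; rewrite (ler0_norm hn) -normrN.
  have -> : - (f x * h - (prim f (h + x) - prim f x)) =
    f x * (x - (h + x)) - (prim f x - prim f (h + x)) by ring.
  have -> : - h = x - (h + x) by ring.
  apply: H; [lra|lra|lra|] => t xt.
  by apply: fd; rewrite (ler0_norm hn) ler_norml; lra.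
have hp : 0 < `|h| by rewrite normr_gt0.
rewrite -(ler_pM2r hp) -normrM; apply: le_trans key.
rewrite le_eqVlt; apply/orP; left; apply/eqP; congr `|_|.
by rewrite -[_ *: _]/(h^-1 * _); field.
Unshelve. all: by end_near. Qed.

End Calculus.

(** * Continuously differentiable functions and a Poincaré inequality with one zero *)

Section C1.
Context {R : realType} (a b : R) (ab : a < b).
Implicit Types (f g h v w : R -> R) (x y c d : R).
Local Notation L2 := (L2 a b).
Local Notation ip := (ip a b).
Local Notation prim := (prim a b).

(** The derivative is asked only inside ]a, b[: [prim f] is constant on each side of the interval
    and in general not differentiable at a and b. Continuity on the whole line puts both functions
    in L^2. *)
Definition C1 v f := [/\ continuous v, continuous f &
  forall x, a < x < b -> is_derive x 1 v (f x)].

Lemma C1_L2 v f : C1 v f -> L2 v /\ L2 f.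
Proof. by case=> cv cf _; split; exact: L2_continuous. Qed.

Lemma C1_prim f : continuous f -> C1 (prim f) f.
Proof.
move=> cf; have lf := L2_continuous a b cf; split => //.
  exact: prim_continuous.
by move=> x xab; apply: is_derive_prim => //; exact: cf.
Qed.

Lemma C1D v f w g : C1 v f -> C1 w g -> C1 (v + w) (f + g).
Proof.
move=> [cv cf dv] [cw cg dw]; split.
- by move=> x; apply: continuousD; [exact: cv|exact: cw].
- by move=> x; apply: continuousD; [exact: cf|exact: cg].
- by move=> x xab; apply: is_deriveD; [exact: dv|exact: dw].
Qed.

Lemma C1Z (k : R) v f : C1 v f -> C1 (k *: v) (k *: f).
Proof.
move=> [cv cf dv]; split.
- by move=> x; apply: continuousZr; exact: cv.
- by move=> x; apply: continuousZr; exact: cf.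
- by move=> x xab; apply: is_deriveZ; exact: dv.
Qed.

Lemma C1_cst (k : R) : C1 (cst k) (cst 0).
Proof.
split; try by move=> x; exact: cst_continuous.
by move=> x _; exact: is_derive_cst.
Qed.

Lemma C1M v f w g : C1 v f -> C1 w g -> C1 (v * w) (f * w + v * g).
Proof.
move=> [cv cf dv] [cw cg dw]; split.
- by move=> x; apply: continuousM; [exact: cv|exact: cw].
- move=> x; apply: continuousD; apply: continuousM;
  [exact: cf|exact: cw|exact: cv|exact: cg].
- move=> x xab; apply: is_derive_eq; first by apply: is_deriveM; [exact: dv|exact: dw].
  by rewrite -[RHS]/(f x * w x + v x * g x) addrC [f x * _]mulrC.
Qed.

Lemma C1_sum n (c : 'I_n -> R) (v f : 'I_n -> R -> R) :
  (forall i, C1 (v i) (f i)) -> C1 (\sum_i c i *: v i) (\sum_i c i *: f i).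
Proof.
move=> vf; elim/big_rec2: _ => [|i x y _ xy]; first exact: (C1_cst 0).
by apply: C1D => //; exact: C1Z.
Qed.

Lemma C1_mono v f c d : C1 v f -> a <= c -> c <= d -> d <= b ->
  (forall x, c < x < d -> 0 <= f x) -> v c <= v d.
Proof.
move=> [cv cf dv] ac cd db f0.
have dvx x : c < x < d -> is_derive x 1 v (f x).
  by move=> /andP[cx xd]; apply: dv; rewrite (le_lt_trans ac cx) (lt_le_trans xd db).
apply: (@ger0_derive1_ndecr _ v c d) => //.
- by move=> x; rewrite in_itv/= => /dvx dx; exact: ex_derive.
- by move=> x; rewrite in_itv/= => /[dup] /dvx dx /f0; rewrite derive1E derive_val.
- exact: continuous_subspaceT.
Qed.

(** The function v - K f has derivative zero; it and its opposite are both nondecreasing, so it is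
    constant on [a, x]. *)
Lemma FTC_C1 v f x : C1 v f -> a <= x <= b -> prim f x = v x - v a.
Proof.
move=> vf /andP[ax xb]; have [lv lf] := C1_L2 vf; have [_ cf _] := vf.
have vp : C1 (v + (-1) *: prim f) (f + (-1) *: f).
  by apply: C1D => //; apply: C1Z; exact: C1_prim.
have vpN : C1 ((-1) *: (v + (-1) *: prim f)) ((-1) *: (f + (-1) *: f)) by exact: C1Z.
have f0 t : (f + (-1) *: f) t = 0 by rewrite -[LHS]/(f t + (-1) * f t); ring.
have := C1_mono vp (lexx a) ax xb (fun t _ => ltac:(by rewrite f0)).
have := C1_mono vpN (lexx a) ax xb (fun t _ =>
  ltac:(by rewrite -[_ t]/((-1) * (f + (-1) *: f) t) f0 mulr0)).
rewrite -[(_ *: (_ + _)) x]/(-1 * (v x + (-1) * prim f x)).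
rewrite -[(_ *: (_ + _)) a]/(-1 * (v a + (-1) * prim f a)).
rewrite -[(_ + _) x]/(v x + (-1) * prim f x) -[(_ + _) a]/(v a + (-1) * prim f a).
by rewrite (prim_left lf (lexx a)); lra.
Qed.

Lemma ip_by_parts v f w g : C1 v f -> C1 w g ->
  ip f w + ip v g = v b * w b - v a * w a.
Proof.
move=> vf wg; have [lv lf] := C1_L2 vf; have [lw lg] := C1_L2 wg.
have vw := C1M vf wg; have [_ lfg] := C1_L2 vw.
have := FTC_C1 (x := b) vw; rewrite lexx ltW// => /(_ isT).
rewrite (prim_right lfg (lexx b)) => <-.
have [cv cf _] := vf; have [cw cg _] := wg.
have lfw : L2 (f * w) by apply: L2_continuous => x; apply: continuousM; [exact: cf|exact: cw].
have lvg : L2 (v * g) by apply: L2_continuous => x; apply: continuousM; [exact: cv|exact: cg].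
rewrite ipDl//; last exact: L2_cst.
by congr (_ + _); apply: eq_Rintegral => x _; rewrite mulr1.
Qed.

(* On [c, d] the slope T x = w tan (w (e - x)) satisfies T' = - w^2 - T^2,
   so that the derivative of (the difference of the two sides) - T v^2
   is the square (f - T v)^2. *)
Lemma half_interval_poincare_lt v f c d (w : R) : C1 v f ->
  a <= c -> c < d -> d <= b -> v c = 0 \/ v d = 0 ->
  0 < w -> w * (d - c) < pi / 2 ->
  w ^+ 2 * (prim (v * v) d - prim (v * v) c) <= prim (f * f) d - prim (f * f) c.
Proof.
move=> vf ac cd db vcd w0 wcd.
have [cv cf dv] := vf.
have cvv : continuous (v * v) by move=> x; apply: continuousM; exact: cv.
have cff : continuous (f * f) by move=> x; apply: continuousM; exact: cf.
have [cV _ dV] := C1_prim cvv; have [cF _ dF] := C1_prim cff.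
(* [e] is the endpoint opposite to the known zero of v: the boundary term T v^2 vanishes at [e]
   because T does, and at the other end because v does. *)
have [e ecd ve] : exists2 e, c <= e <= d & (e = c /\ v d = 0) \/ (e = d /\ v c = 0).
  by case: vcd => vE; [exists d|exists c]; rewrite ?lexx ?(ltW cd)//; [right|left].
(* The strict bound w (d - c) < pi / 2 keeps the argument of the tangent inside ]-pi/2, pi/2[ on the
   closed interval. *)
have cosn0 x : c <= x <= d -> cos (w * (e - x)) != 0.
  move=> xcd; rewrite gt_eqF// cos_gt0_pihalf//.
  have h1 : w * (e - x) <= w * (d - c) by rewrite ler_pM2l//; lra.
  have h2 : w * (x - e) <= w * (d - c) by rewrite ler_pM2l//; lra.
  by move: h2; rewrite -opprB mulrN; lra.
pose T x := w * tan (w * (e - x)).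
have dT x : c <= x <= d -> is_derive x 1 T (- w ^+ 2 - T x ^+ 2).
  move=> xcd.
  have d1 : is_derive x 1 (w *: (cst e - id)) (- w).
    apply: is_derive_eq; rewrite -[_ *: (_ - _)]/(w * (0 - 1)); ring.
  have d2 : is_derive x 1 (tan \o (w *: (cst e - id))) ((cos (w * (e - x))) ^- 2 * - w).
    by apply: is_derive1_comp; exact: is_derive_tan (cosn0 x xcd).
  suff -> : - w ^+ 2 - T x ^+ 2 = w *: ((cos (w * (e - x))) ^- 2 * - w).
    exact: (is_deriveZ w d2).
  by rewrite -[_ *: _]/(w * _) cos2_tan2 ?cosn0// /T; ring.
pose P := prim (f * f) - w ^+ 2 *: prim (v * v) - T * (v * v).
have PE x : P x = prim (f * f) x - w ^+ 2 * prim (v * v) x - T x * (v x * v x) by [].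
have dP x : c < x < d -> is_derive x 1 P ((f x - T x * v x) ^+ 2).
  move=> /andP[cx xd].
  have xab : a < x < b by rewrite (le_lt_trans ac cx) (lt_le_trans xd db).
  have dTx : is_derive x 1 T (- w ^+ 2 - T x ^+ 2) by apply: dT; rewrite !ltW.
  have dFx := dF x xab; have dVx := dV x xab; have dvx := dv x xab.
  apply: is_derive_eq.
  rewrite -[(f * f) x]/(f x * f x) -[(v * v) x]/(v x * v x).
  rewrite -[_ *: (v x * v x)]/(_ * _) -[_ *: (_ + _)]/(_ * (v x * f x + v x * f x)).
  by rewrite -[_ *: (_ - _)]/(v x * v x * (- w ^+ 2 - T x ^+ 2)); ring.
have cP : {within `[c, d], continuous P}.
  apply: continuous_in_subspaceT => x; rewrite inE/= in_itv/= => xcd.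
  have cT : {for x, continuous T}.
    apply: differentiable_continuous; apply/derivable1_diffP.
    by have := dT x xcd => dTx; exact: ex_derive.
  apply: continuousB; first apply: continuousB; first exact: cF.
    by apply: continuousZr; exact: cV.
  by apply: continuousM => //; exact: cvv.
have : P c <= P d.
  apply: (@ger0_derive1_ndecr _ P c d) => //.
  - by move=> x; rewrite in_itv/= => /dP dx; exact: ex_derive.
  - by move=> x; rewrite in_itv/= => /dP dx; rewrite derive1E derive_val sqr_ge0.
  - exact: ltW.
rewrite !PE.
have Te : T e = 0 by rewrite /T subrr mulr0 tan0 mulr0.
by case: ve => -[ee vE]; move: Te; rewrite ee vE => ->; lra.
Qed.

(** The critical frequency is the supremum of the admissible w. If the inequality failed there with
    G > 0 and F >= 0, the midpoint between the square root of F / G and [w0] would already violate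
    the strict case; for the other signs [w0 / 2] does. *)
Lemma half_interval_poincare v f c d : C1 v f ->
  a <= c -> c < d -> d <= b -> v c = 0 \/ v d = 0 ->
  (pi / (2 * (d - c))) ^+ 2 * (prim (v * v) d - prim (v * v) c) <=
  prim (f * f) d - prim (f * f) c.
Proof.
move=> vf ac cd db vcd.
set G := prim (v * v) d - _; set F := prim (f * f) d - _.
set w0 := pi / _.
have dc0 : 0 < d - c by rewrite subr_gt0.
have w00 : 0 < w0 by rewrite divr_gt0 ?pi_gt0// mulr_gt0.
have h (w : R) : 0 < w -> w < w0 -> w ^+ 2 * G <= F.
  move=> wp ww; apply: half_interval_poincare_lt => //.
  have -> : pi / 2 = w0 * (d - c) by rewrite /w0; field; rewrite gt_eqF.
  by rewrite ltr_pM2r.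
rewrite leNgt; apply/negP => FG.
have [G0|Gp] := leP G 0.
  have := h (w0 / 2) ltac:(lra) ltac:(lra).
  have : (w0 / 2) ^+ 2 * G >= w0 ^+ 2 * G by nra.
  by lra.
have [F0|Fp] := ltP F 0.
  have := h (w0 / 2) ltac:(lra) ltac:(lra).
  have : 0 < (w0 / 2) ^+ 2 * G by rewrite mulr_gt0// exprn_gt0//; lra.
  by lra.
pose s := Num.sqrt (F / G).
have s2 : s ^+ 2 = F / G by rewrite sqr_sqrtr// divr_ge0// ltW.
have s0 : 0 <= s by exact: sqrtr_ge0.
have sw : s < w0.
  rewrite -(ltr_pXn2r (n := 2))// ?nnegrE ?ltW//.
  by rewrite s2 ltr_pdivrMr.
pose w := (s + w0) / 2.
have := h w ltac:(rewrite /w; lra) ltac:(rewrite /w; lra).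
rewrite -ler_pdivlMr// -s2 leNgt => /negP; apply.
by rewrite ltr_pXn2r// ?nnegrE /w; lra.
Qed.

End C1.

(** * Sines and cosines: orthogonality and norms *)

Section Trigonometric.
Context {R : realType} (a b : R) (ab : a < b).
Implicit Types (f g h v w : R -> R) (x y c d : R).
Local Notation L2 := (L2 a b).
Local Notation ip := (ip a b).
Local Notation C1 := (C1 a b).

Definition freq (k : nat) : R := k%:R * pi / (b - a).

(* The j-th derivative of cos (w (x - a)) is w^j cos (w (x - a) + j pi / 2). *)
Definition trig (k j : nat) : R -> R :=
  fun x => cos (freq k * (x - a) + j%:R * (pi / 2)).

Lemma freq_ge0 k : 0 <= freq k.
Proof. by rewrite divr_ge0 ?mulr_ge0 ?pi_ge0// subr_ge0 ltW. Qed.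

Lemma freq_lt k l : (k < l)%N -> freq k < freq l.
Proof.
move=> kl; rewrite /freq -!mulrA ltr_pM2r ?ltr_nat//.
by rewrite divr_gt0 ?pi_gt0// subr_gt0.
Qed.

Lemma freq_inj k l : freq k = freq l -> k = l.
Proof.
move=> e; have [/freq_lt|/freq_lt|//] := ltngtP k l; by rewrite e ltxx.
Qed.

Lemma freq0 : freq 0 = 0. Proof. by rewrite /freq !mul0r. Qed.

Lemma trigS k j x : trig k j.+1 x = - sin (freq k * (x - a) + j%:R * (pi / 2)).
Proof. by rewrite /trig -natr1 mulrDl mul1r addrA cosDpihalf. Qed.

Lemma trigSS k j x : trig k j.+2 x = - trig k j x.
Proof.
rewrite trigS /trig -[j.+1%:R]natr1 mulrDl mul1r addrA; congr (- _).
by rewrite sinDpihalf.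
Qed.

Lemma C1_trig k j : C1 (trig k j) (freq k *: trig k j.+1).
Proof.
have ct i : continuous (trig k i).
  move=> x; apply: (@continuous_comp _ _ _ (fun x => freq k * (x - a) + i%:R * (pi / 2)) cos).
    apply: continuousD; last exact: cst_continuous.
    apply: continuousM; first exact: cst_continuous.
    by apply: continuousB; [exact: cvg_id|exact: cst_continuous].
  exact: continuous_cos.
split => //; first by move=> x; apply: continuousZr; exact: ct.
move=> x _; rewrite -[(_ *: _) x]/(freq k * trig k j.+1 x) trigS.
have -> : trig k j = cos \o (freq k *: (id - cst a) + cst (j%:R * (pi / 2))) by [].
set u := (freq k *: _ + _).
have du : is_derive x 1 u (freq k).
  apply: is_derive_eq; rewrite addr0 -[_ *: (_ - _)]/(freq k * (1 - 0)).
  by rewrite subr0 mulr1.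
rewrite mulrC; apply: is_derive1_comp.
Qed.

Lemma L2_trig k j : L2 (trig k j).
Proof. by have [] := C1_L2 (C1_trig k j). Qed.

Lemma cosDnpi x n : cos (x + n%:R * pi) = (-1) ^+ n * cos x.
Proof.
elim: n => [|n IH]; first by rewrite mul0r addr0 expr0 mul1r.
by rewrite -natr1 mulrDl mul1r addrA cosDpi IH exprS mulN1r mulNr.
Qed.

Lemma freqL k : freq k * (b - a) = k%:R * pi.
Proof. by rewrite /freq divfK// subr_eq0 gt_eqF. Qed.

Lemma trig_a k j : trig k j a = cos (j%:R * (pi / 2)).
Proof. by rewrite /trig subrr mulr0 add0r. Qed.

Lemma trig_b k j : trig k j b = (-1) ^+ k * cos (j%:R * (pi / 2)).
Proof. by rewrite /trig freqL addrC cosDnpi. Qed.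

Lemma trig_odd_endpoints k : trig k 1 a = 0 /\ trig k 1 b = 0.
Proof. by rewrite trig_a trig_b mul1r cos_pihalf mulr0. Qed.

(** One of j and j + 1 is odd, and the cosine vanishes at odd multiples of pi / 2. This removes the
    boundary terms when consecutive phases are integrated by parts against each other. *)
Lemma cos_mul_shift j : cos (j%:R * (pi / 2)) * cos (j.+1%:R * (pi / 2)) = 0 :> R.
Proof.
elim: j => [|j IH]; first by rewrite mul1r cos_pihalf mulr0.
have -> : cos (j.+2%:R * (pi / 2)) = - cos (j%:R * (pi / 2)) :> R.
  by rewrite -natr1 -natr1 2!mulrDl mul1r -addrA -splitr cosDpi.
by rewrite mulrN mulrC IH oppr0.
Qed.

Lemma ip_trig_shift k l j :
  freq k * ip (trig k j.+1) (trig l j.+1) = freq l * ip (trig k j) (trig l j).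
Proof.
have := ip_by_parts ab (C1_trig k j) (C1_trig l j.+1).
have lt := L2_trig.
rewrite !trig_a !trig_b ipZl// ipZr//.
have -> : trig l j.+2 = (-1) *: trig l j.
  by apply/funext => x; rewrite trigSS -[RHS]/(-1 * _) mulN1r.
rewrite ipZr//; move: (cos_mul_shift j).
move: (cos (j%:R * (pi / 2))) (cos (j.+1%:R * (pi / 2))) => A B AB0.
have -> : (-1) ^+ k * A * ((-1) ^+ l * B) = (-1) ^+ k * (-1) ^+ l * (A * B) by ring.
by rewrite AB0 mulr0 subr0; lra.
Qed.

(** [ip_trig_shift], applied with k and l in both orders, gives (freq k^2 - freq l^2) <trig k j,
    trig l j> = 0. *)
Lemma ip_trig_orth k l j : k != l -> ip (trig k j) (trig l j) = 0.
Proof.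
move=> kl.
have h1 := ip_trig_shift k l j.
have h2 : freq l * ip (trig k j.+1) (trig l j.+1) = freq k * ip (trig k j) (trig l j).
  by rewrite ipC ip_trig_shift ipC.
have : (freq k ^+ 2 - freq l ^+ 2) * ip (trig k j) (trig l j) = 0.
  transitivity (freq k * (freq k * ip (trig k j) (trig l j)) -
                freq l * (freq l * ip (trig k j) (trig l j))); first by ring.
  by rewrite -h1 -h2; ring.
move/eqP; rewrite mulf_eq0 => /orP[|/eqP//].
rewrite subr_eq0 eqrXn2 ?freq_ge0// => /eqP /freq_inj e.
by rewrite e eqxx in kl.
Qed.

Lemma trig_sqr k j x : trig k j x * trig k j x + trig k j.+1 x * trig k j.+1 x = 1.
Proof. by rewrite trigS /trig mulrNN -!expr2 cos2Dsin2. Qed.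

Lemma ip_cst1 : ip (cst 1) (cst 1) = b - a.
Proof.
have := ip_cst1_belowB (lexx a) (ltW ab) (lexx b) => <-.
apply: eq_ip => //; try exact: L2_cst.
- by apply: L2B; exact: L2_below.
- by apply: ae_itv.
- apply: ae_itv => x /andP[ax xb] _.
  by rewrite below_subE ?(ltW ab)// (ltW ax) xb.
Qed.

(** For k > 0 consecutive phases have the same norm, and their squares add up to 1 pointwise, so
    each gets half of b - a. *)
Lemma ip_trig_sqr k j : (0 < k)%N -> ip (trig k j) (trig k j) = (b - a) / 2.
Proof.
move=> k0.
have e : ip (trig k j.+1) (trig k j.+1) = ip (trig k j) (trig k j).
  have := ip_trig_shift k k j; apply: mulfI.
  by rewrite gt_eqF// -freq0 freq_lt.
have : ip (trig k j) (trig k j) + ip (trig k j.+1) (trig k j.+1) = b - a.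
  rewrite -ip_cst1 -[LHS]/(Rintegral _ _ _ + Rintegral _ _ _) -RintegralD//.
  - by apply: eq_Rintegral => x _; rewrite trig_sqr mulr1.
  - by apply: L2_mul_integrable; exact: L2_trig.
  - by apply: L2_mul_integrable; exact: L2_trig.
by rewrite e; lra.
Qed.

Lemma ip_trig_gt0 k j : (0 < k)%N || (j == 0%N) -> 0 < ip (trig k j) (trig k j).
Proof.
case: k => [/=/eqP->|k _]; last by rewrite ip_trig_sqr// divr_gt0// subr_gt0.
have -> : trig 0 0 = cst 1.
  by apply/funext => x; rewrite /trig freq0 !mul0r addr0 cos0.
by rewrite ip_cst1 subr_gt0.
Qed.

End Trigonometric.

(** * Wirtinger's inequality under orthogonality conditions *)

Lemma exists_left_kernel (F : fieldType) m n (A : 'M[F]_(n, m)) : (m < n)%N ->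
  exists2 u : 'rV[F]_n, u != 0 & u *m A = 0.
Proof.
move=> mn; exists (nz_row (kermx A)).
  rewrite nz_row_eq0 -mxrank_eq0 mxrank_ker subn_eq0 -ltnNge.
  exact: leq_ltn_trans (rank_leq_col A) mn.
by apply/sub_kermxP; exact: nz_row_sub.
Qed.

Section Wirtinger.
Context {R : realType} (a b : R) (ab : a < b).
Implicit Types (f g h v w : R -> R) (x y c d : R).
Local Notation L2 := (L2 a b).
Local Notation ip := (ip a b).
Local Notation prim := (prim a b).
Local Notation C1 := (C1 a b).
Local Notation trig := (trig a b).
Local Notation freq := (freq a b).

Lemma ip_sum_orth n (c : 'I_n -> R) (e : 'I_n -> R -> R) :
  (forall i, L2 (e i)) -> (forall i j, i != j -> ip (e i) (e j) = 0) ->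
  ip (\sum_i c i *: e i) (\sum_i c i *: e i) = \sum_i c i ^+ 2 * ip (e i) (e i).
Proof.
move=> le eo; rewrite ip_suml//; last exact: L2_sum.
apply: eq_bigr => i _; rewrite ip_sumr// (bigD1 i)//= big1 ?addr0 ?mulrA//.
by move=> j ji; rewrite eo ?mulr0// eq_sym.
Qed.

(** Each of the N pieces of length (b - a) / N has a zero of v at one end; the inequalities of
    [half_interval_poincare] on the pieces have the same constant and add up. *)
Lemma poincare_nodes v f (N : nat) : C1 v f -> (0 < N)%N ->
  (forall i, (i < N)%N -> v (a + i%:R * ((b - a) / N%:R)) = 0 \/
                       v (a + i.+1%:R * ((b - a) / N%:R)) = 0) ->
  (N%:R * pi / (2 * (b - a))) ^+ 2 * ip v v <= ip f f.
Proof.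
move=> vf N0 v0; have [lv lf] := C1_L2 vf; have [cv cf _] := vf.
have N0' : 0 < N%:R :> R by rewrite ltr0n.
have ba : 0 < b - a by rewrite subr_gt0.
have lvv : L2 (v * v) by apply: L2_continuous => x; apply: continuousM; exact: cv.
have lff : L2 (f * f) by apply: L2_continuous => x; apply: continuousM; exact: cf.
pose h := (b - a) / N%:R.
have h0 : 0 < h by rewrite divr_gt0.
have hN : N%:R * h = b - a by rewrite mulrC divfK// gt_eqF.
have kE : N%:R * pi / (2 * (b - a)) = pi / (2 * h).
  by rewrite -hN; field; rewrite !gt_eqF.
have step i : (i <= N)%N ->
  (pi / (2 * h)) ^+ 2 * prim (v * v) (a + i%:R * h) <= prim (f * f) (a + i%:R * h).
  elim: i => [_|i IH iN].
    by rewrite mul0r addr0 !prim_left// mulr0.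
  have := IH (ltnW iN).
  have := half_interval_poincare vf _ _ _ (v0 i iN).
  have -> : a + i.+1%:R * ((b - a) / N%:R) - (a + i%:R * ((b - a) / N%:R)) = h.
    by rewrite -natr1 /h; ring.
  rewrite -/h => H; have := H _ _ _; rewrite mulrBr => {}H; have {}H := H _ _ _.
  have : a + i%:R * h < a + i.+1%:R * h by rewrite ltrD2l ltr_pM2r// ltr_nat.
  have : a + i.+1%:R * h <= b.
    have : i.+1%:R * h <= N%:R * h by rewrite ler_pM2r// ler_nat.
    by rewrite hN; lra.
  have : a <= a + i%:R * h by rewrite lerDl mulr_ge0// ltW.
  by move=> h1 h2 h3; have := H h1 h3 h2; lra.
have := step N (leqnn N); rewrite hN addrC subrK -kE !prim_right//.
suff e g : ip (g * g) (cst 1) = ip g g by rewrite !e.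
by apply: eq_Rintegral => x _; rewrite mulr1.
Qed.

(* Otherwise the quadratic form |v'|^2 - (freq m)^2 |v|^2 would be negative
   definite on the span of w and of the m functions trig k s; that span
   contains a nonzero v vanishing at enough equidistant points to contradict
   poincare_nodes. *)
Lemma wirtinger (s m : nat) w f : (s <= 1)%N -> (0 < m)%N -> C1 w f ->
  (s = 1%N -> w a = 0 /\ w b = 0) ->
  (forall k, (k < m)%N -> ip w (trig k s) = 0) ->
  freq m ^+ 2 * ip w w <= ip f f.
Proof.
move=> s1 m0 wf w0 wt; have [lw lf] := C1_L2 wf.
have lt := L2_trig a b.
rewrite leNgt; apply/negP => contra.
pose e (k : 'I_m) := trig k s.
(* The interval is cut into 2 m pieces. For s = 0 the nodes are the m odd multiples of the step; for
   s = 1 they are the even ones except b, where v vanishes anyway. Every piece then has a node or b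
   at one end. *)
pose node (i : 'I_m) : R := a + (2 * i + (s == 0))%:R * ((b - a) / (2 * m)%:R).
(* For s = 1 the condition at the node a holds for free. It is replaced by the vanishing of the
   coefficient of [trig 0 1], which is the zero function and would otherwise allow a trivial
   solution. *)
pose cond (i : 'I_m) (v : R -> R) (c0 : R) : R :=
  if (s == 1)%N && (i == 0 :> nat) then c0 else v (node i).
pose A : 'M[R]_(m.+1, m) := \matrix_(j, i)
  match unlift ord0 j with
  | None => cond i w 0
  | Some k => cond i (e k) (k == 0 :> nat)%:R
  end.
(* One more unknown than conditions: the coefficient of w and those of the m trigonometric
   functions. *)
have [u u0 uA] := exists_left_kernel A (ltnSn m).
pose g := u 0 ord0; pose c (k : 'I_m) := u 0 (lift ord0 k).
pose v := g *: w + \sum_k c k *: e k.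
pose f' := g *: f + \sum_k c k *: (freq k *: trig k s.+1).
have vf : C1 v f'.
  by apply: C1D; [exact: C1Z|apply: C1_sum => k; exact: C1_trig].
have vE x : v x = g * w x + \sum_k c k * e k x.
  rewrite -[LHS]/(g * w x + (\sum_k c k *: e k) x); congr (_ + _).
  by rewrite fct_sumE.
have cond0 i : g * cond i w 0 + \sum_k c k * cond i (e k) (k == 0 :> nat)%:R = 0.
  have := congr1 (fun M : 'rV_m => M 0 i) uA; rewrite !mxE big_ord_recl !mxE unlift_none.
  move=> sum0; rewrite -[RHS]sum0; congr (_ + _); apply: eq_bigr => k _.
  by rewrite !mxE liftK.
have c0 : s = 1%N -> forall k : 'I_m, k = 0%N :> nat -> c k = 0.
  move=> sE k k0; have := cond0 k; rewrite /cond sE k0 eqxx/= mulr0 add0r => <-.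
  rewrite (bigD1 k)//= k0 eqxx mulr1 big1 ?addr0// => l lk.
  case: eqP => [l0|_]; last by rewrite mulr0.
  by case/eqP: lk; apply: val_inj; rewrite /= l0 k0.
have vnode (i : 'I_m) : (s == 1)%N && (i == 0 :> nat) = false -> v (node i) = 0.
  by move=> si; have := cond0 i; rewrite /cond si => <-; rewrite vE; congr (_ + _).
have vend : s = 1%N -> v a = 0 /\ v b = 0.
  move=> sE; have [wa wb] := w0 sE; rewrite !vE wa wb !mulr0 !add0r.
  by split; apply: big1 => k _; rewrite /e sE;
    have [ta tb] := trig_odd_endpoints ab k; rewrite ?ta ?tb mulr0.
pose h := (b - a) / (2 * m)%:R.
have hN : (2 * m)%:R * h = b - a.
  by rewrite mulrC divfK// pnatr_eq0 muln_eq0/= -lt0n.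
have vz i : (i <= 2 * m)%N -> odd i = (s == 0)%N -> v (a + i%:R * h) = 0.
  move=> im io; pose j := i./2.
  have iE : i = (2 * j + (s == 0))%N by rewrite mul2n addnC -io odd_double_half.
  have [jm|mj] := ltnP j m; last first.
    have [sE iE'] : s = 1%N /\ i = (2 * m)%N.
      by clear -s1 im iE mj; case: s s1 iE => [|[]]//= _; lia.
    rewrite iE'.
    by rewrite hN addrC subrK; have [] := vend sE.
  have [/andP[/eqP sE /eqP /= j0]|] := boolP ((s == 1)%N && (Ordinal jm == 0 :> nat)).
    have -> : i = 0%N by rewrite iE sE j0.
    by rewrite mul0r addr0; have [] := vend sE.
  by move=> /negbTE /vnode; rewrite /node /= -iE.
have vzz i : (i < 2 * m)%N -> v (a + i%:R * h) = 0 \/ v (a + i.+1%:R * h) = 0.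
  move=> im; have [io|io] := eqVneq (odd i) (s == 0)%N.
    by left; apply: vz => //; exact: ltnW.
  right; apply: vz => //=.
  by case: (odd i) (s == 0)%N io => -[].
have m20 : (0 < 2 * m)%N by rewrite muln_gt0.
have := poincare_nodes vf m20 vzz.
have -> : (2 * m)%:R * pi / (2 * (b - a)) = freq m.
  rewrite -[freq m]/(m%:R * pi / (b - a)) natrM; field.
  by rewrite subr_eq0 gt_eqF.
have le k : L2 (e k) by exact: lt.
have split_ip (x y : R -> R) (ee : 'I_m -> R -> R) : L2 x -> (forall k, L2 (ee k)) ->
    (forall k l, k != l -> ip (ee k) (ee l) = 0) -> (forall k, ip x (ee k) = 0) ->
    ip (g *: x + \sum_k c k *: ee k) (g *: x + \sum_k c k *: ee k) =
    g ^+ 2 * ip x x + \sum_k c k ^+ 2 * ip (ee k) (ee k).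
  move=> lx lee eeo xee; have lS := L2_sum c lee; have lgx := L2Z g lx.
  have xS : ip x (\sum_k c k *: ee k) = 0.
    by rewrite ip_sumr// big1// => k _; rewrite xee mulr0.
  rewrite ipDl// ?ipDr//; last exact: L2D.
  rewrite ip_sum_orth// !ipZl// ipZr// [ip _ (g *: x)]ipC ipZl// xS; ring.
(* The orthogonality of w passes to w' by parts: the boundary terms vanish through the sines if s =
   0 and through w if s = 1. Both quadratic forms are thus diagonal in w and the trigonometric
   functions. *)
have ft k : (k < m)%N -> ip f (trig k s.+1) = 0.
  move=> km; have := ip_by_parts ab wf (C1_trig a b k s.+1).
  have -> : trig k s.+2 = (-1) *: trig k s.
    by apply/funext => x; rewrite trigSS -[RHS]/(-1 * _) mulN1r.
  rewrite ipZr ?ipZr ?wt// ?mulr0 ?addr0 => [->|]; last exact: L2Z.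
  case: (s) s1 w0 => [|[]]// _ w0.
    by have [-> ->] := trig_odd_endpoints ab k; rewrite !mulr0 subr0.
  by have [-> ->] := w0 erefl; rewrite !mul0r subr0.
rewrite (split_ip w f)//; last 2 first.
- by move=> k l kl; apply: ip_trig_orth.
- by move=> k; apply: wt.
rewrite (split_ip f f)//; last 3 first.
- by move=> k; exact: L2Z.
- by move=> k l kl; rewrite ipZl ?ipZr ?ip_trig_orth ?mulr0//; exact: L2Z.
- by move=> k; rewrite ipZr// ft// mulr0.
have e2 k : ip (freq k *: trig k s.+1) (freq k *: trig k s.+1) =
    freq k ^+ 2 * ip (trig k s) (trig k s).
  rewrite ipZl ?ipZr//; last exact: L2Z.
  by rewrite ip_trig_shift//; ring.
under [in X in _ <= X]eq_bigr do rewrite e2.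
(* The inequality at the nodes becomes: the sum of the nonnegative [d k] is at most g^2 (|f|^2 -
   (freq m)^2 |w|^2). The right-hand factor is negative by [contra], so g = 0, then every [d k] is
   0, and u = 0 follows. *)
pose d (k : 'I_m) := c k ^+ 2 * ((freq m ^+ 2 - freq k ^+ 2) * ip (e k) (e k)).
have f2 (k : 'I_m) : 0 < freq m ^+ 2 - freq k ^+ 2.
  by rewrite subr_gt0 ltr_pXn2r ?nnegrE ?freq_ge0// freq_lt.
have d0 k : 0 <= d k by rewrite mulr_ge0 ?sqr_ge0// mulr_ge0 ?ip_ge0// ltW.
have dE : \sum_k d k = freq m ^+ 2 * (\sum_k c k ^+ 2 * ip (e k) (e k)) -
    \sum_k c k ^+ 2 * (freq k ^+ 2 * ip (e k) (e k)).
  by rewrite mulr_sumr -sumrB; apply: eq_bigr => k _; rewrite /d; ring.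
move=> H.
have Hd : 0 <= \sum_k d k by apply: sumr_ge0.
have H2 : \sum_k d k <= g ^+ 2 * (ip f f - freq m ^+ 2 * ip w w).
  by rewrite dE mulrBr; move: H; rewrite mulrDr; lra.
have g0 : g = 0.
  apply/eqP; rewrite -sqrf_eq0 eq_le sqr_ge0 andbT leNgt; apply/negP => gp.
  have : g ^+ 2 * (ip f f - freq m ^+ 2 * ip w w) < 0 by rewrite pmulr_rlt0// subr_lt0.
  by lra.
have ds : \sum_k d k = 0.
  by apply/eqP; rewrite eq_le Hd andbT; move: H2; rewrite g0 expr0n mul0r.
have {}c0 k : c k = 0.
  have [/eqP/andP[/eqP k0 sE]|ks] := boolP ((k == 0 :> nat) && (s == 1)%N == true).
    by apply: c0 => //; exact/eqP.
  have /eqP : d k = 0 by apply: (psumr_eq0P _ ds).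
  rewrite mulf_eq0 sqrf_eq0 => /orP[/eqP//|]; rewrite gt_eqF// mulr_gt0//.
  apply: ip_trig_gt0 => //; move: ks; rewrite eqb_id negb_and -lt0n.
  by case: (s) s1 => [|[]]//; rewrite !orbT.
case/eqP: u0; apply/rowP => j; rewrite mxE.
by case: (unliftP ord0 j) => [k ->|->]; [exact: c0|exact: g0].
Qed.

End Wirtinger.

(** * A function whose primitive vanishes is null *)

Section PrimitiveZero.
Context {R : realType} (a b : R) (ab : a < b).
Implicit Types (f g h z : R -> R) (x y : R).
Local Notation mu := (leb_itv a b).
Local Notation leb := (@lebesgue_measure R).
Local Notation L2 := (L2 a b).
Local Notation prim := (prim a b).

Lemma integral_leb_itv_setI f : 
  (\int[mu]_(x in `]a, b[) (f x)%:E = \int[leb]_(x in `]a, b[) (f x)%:E)%E.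
Proof.
apply: eq_measure_integral => A mA Aab.
by rewrite /leb_itv/= /mrestr setIidl.
Qed.

Lemma itvC_negligible : measurable (~` `]a, b[%classic : set (measurableTypeR R)).
Proof. exact: measurableC. Qed.

Lemma integral_leb_itv f : mu.-integrable setT (EFin \o f) ->
  (\int[mu]_x (f x)%:E = \int[leb]_(x in `]a, b[) (f x)%:E)%E.
Proof.
move=> fi; rewrite (negligible_integral itvC_negligible measurableT fi) ?leb_itv_off//.
by rewrite setTD setCK integral_leb_itv_setI.
Qed.

Lemma integrable_leb_itv f : mu.-integrable setT (EFin \o f) ->
  leb.-integrable `]a, b[ (EFin \o f).
Proof.
move=> fi; have /integrableP[mf ifa] := fi.
apply/integrableP; split; first exact: (measurable_funTS mf).
have fia : mu.-integrable setT (EFin \o (fun x => `|f x|)).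
  by have := integrable_abse fi; apply: eq_integrable.
by rewrite -(integral_leb_itv fia).
Qed.

Lemma integrable_leb_restrict f : mu.-integrable setT (EFin \o f) ->
  leb.-integrable setT (EFin \o (f \_ `]a, b[)).
Proof.
move=> /integrable_leb_itv fi; rewrite -restrict_EFin.
exact: (@integrable_mkcond _ _ _ leb `]a, b[%classic (EFin \o f) (measurable_itv `]a, b[)).1.
Qed.

Lemma prim_restrictE f x : L2 f ->
  \int[leb]_(t in `]-oo, x]) (f \_ `]a, b[) t = prim f x.
Proof.
move=> lf; have fi := integrable_leb_restrict (L2_integrable lf).
rewrite -Rintegral_itv_bndo_bndc; last by apply: (integrableS _ _ _ fi).
rewrite Rintegral_mkcond /Rintegral -[prim f x]/(fine (\int[mu]_t _)%E).
rewrite (integral_leb_itv (L2_mul_integrable lf (L2_below a b x))).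
rewrite [in RHS]integral_mkcond; congr fine; apply: eq_integral => t _ /=.
rewrite !patchE !mem_setE !in_itv/= /below.
by case: (t < x); case: (a < t < b) => /=; rewrite ?mulr1 ?mulr0.
Qed.

(** Lebesgue's differentiation theorem, applied to f cut off outside ]a, b[: the primitive of that
    function from -oo is [prim f]. *)
Lemma prim_eq0_ae f : L2 f -> (forall x, prim f x = 0) -> f = 0 %[ae mu].
Proof.
move=> lf f0; have fi := integrable_leb_restrict (L2_integrable lf).
have /FTC1Ny : forall y, leb.-integrable `]-oo, y] (EFin \o (f \_ `]a, b[)).
  by move=> y; apply: (integrableS _ _ _ fi).
have floc : locally_integrable setT (f \_ `]a, b[).
  by apply: integrable_locally => //; exact/integrable_leb_itv/L2_integrable.
move=> /(_ floc) /=.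
have -> : (fun x => \int[leb]_(t in `]-oo, x]) (f \_ `]a, b[) t) = cst 0.
  by apply/funext => x; rewrite prim_restrictE.
move=> [N [mN N0 sN]]; exists (N `|` ~` `]a, b[); split.
- by apply: measurableU => //; exact: itvC_negligible.
- transitivity (mu N); first exact: (measureU0 mN itvC_negligible (leb_itv_off a b)).
  apply/eqP; rewrite eq_le measure_ge0 andbT /leb_itv/= /mrestr -N0.
  apply: le_measure; rewrite ?inE.
  + by apply: measurableI => //; exact: measurable_itv.
  + exact: mN.
  + exact: subIsetl.
- move=> x /= nfx; have [xab|] := boolP (x \in `]a, b[); last by right=> /=; apply/negP.
  left; apply: sN => /= -[_]; rewrite derive1_cst patchE mem_setE xab => e.
  by apply: nfx; rewrite -e.
Qed.

End PrimitiveZero.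

(** * Stability properties of smooth functions *)

Section Smooth.
Context {R : realType}.
Implicit Types (f g : R -> R) (x : R).

Definition smooth f := forall k x, derivable (derive1n k f) x 1.

Lemma smooth_coind (S : set (R -> R)) :
  (forall f, S f -> (forall x, derivable f x 1) /\ S (derive1 f)) ->
  forall f, S f -> smooth f.
Proof.
move=> h f Sf k; suff : S (derive1n k f) by move=> /h[].
by elim: k => // k IH; rewrite derive1nS; have [] := h _ IH.
Qed.

Lemma derive1n_derive1 f k : derive1n k (derive1 f) = derive1n k.+1 f.
Proof. exact/esym/iterSr. Qed.

Lemma smooth_derive1 f : smooth f -> smooth (derive1 f).
Proof. by move=> sf k x; rewrite derive1n_derive1; exact: sf. Qed.

Lemma smooth_derivable f x : smooth f -> derivable f x 1.
Proof. by move=> /(_ 0%N x). Qed.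

Lemma smooth_is_derive f x : smooth f -> is_derive x 1 f ((derive1 f) x).
Proof.
by move=> sf; rewrite derive1E; apply: derivableP; exact: smooth_derivable.
Qed.

Lemma smooth_continuous f : smooth f -> continuous f.
Proof.
move=> sf x; apply: differentiable_continuous; apply/derivable1_diffP.
exact: smooth_derivable.
Qed.

Lemma derive1_ext f g : (forall x, is_derive x 1 f (g x)) -> (derive1 f) = g.
Proof. by move=> fg; apply/funext => x; rewrite derive1E; exact: derive_val. Qed.

Lemma smoothP f g : (forall x, is_derive x 1 f (g x)) -> smooth g -> smooth f.
Proof.
move=> fg sg [|k] x; first exact: ex_derive.
by rewrite -derive1n_derive1 (derive1_ext fg); exact: sg.
Qed.

(** Products of smooth functions are not stable under derivation, but sums of them are, by Leibniz's
    rule; this is the invariant class handed to [smooth_coind]. *)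
Inductive sum_of_products : (R -> R) -> Prop :=
| SumOfProductsM f g : smooth f -> smooth g -> sum_of_products (f * g)
| SumOfProductsD f g : sum_of_products f -> sum_of_products g ->
    sum_of_products (f + g).

Lemma sum_of_products_derive f : sum_of_products f ->
  (forall x, derivable f x 1) /\ sum_of_products (derive1 f).
Proof.
elim=> {f} [f g sf sg|f g _ [df Sf] _ [dg Sg]].
  have d x : is_derive x 1 (f * g) ((f * (derive1 g) + (derive1 f) * g) x).
    have dfx := smooth_is_derive x sf; have dgx := smooth_is_derive x sg.
    by apply: is_derive_eq; rewrite [(derive1 f) * g]mulrC.
  split; first by move=> x; exact: ex_derive.
  rewrite (derive1_ext d).
  exact: (SumOfProductsD (SumOfProductsM sf (smooth_derive1 sg))
                         (SumOfProductsM (smooth_derive1 sf) sg)).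
have d x : is_derive x 1 (f + g) (((derive1 f) + (derive1 g)) x).
  have dfx : is_derive x 1 f ((derive1 f) x) by rewrite derive1E; exact: derivableP.
  have dgx : is_derive x 1 g ((derive1 g) x) by rewrite derive1E; exact: derivableP.
  exact: is_derive_eq.
by split=> [x|]; [exact: ex_derive|rewrite (derive1_ext d); exact: SumOfProductsD].
Qed.

Lemma smoothM f g : smooth f -> smooth g -> smooth (f * g).
Proof.
move=> sf sg; apply: (smooth_coind sum_of_products_derive).
exact: SumOfProductsM.
Qed.

Lemma smoothD f g : smooth f -> smooth g -> smooth (f + g).
Proof.
move=> sf sg; have smooth1 : smooth (cst 1).
  have c (k : R) : forall x : R, is_derive x 1 (cst k) (cst 0 x).
    by move=> x; exact: is_derive_cst.
  apply: (@smooth_coind [set f | exists k : R, f = cst k]); last by exists 1.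
  move=> _ [k ->]; split; first by move=> x; have dx := c k x; exact: ex_derive.
  by exists 0; rewrite (derive1_ext (c k)).
(* Writing the sum as f 1 + g 1 lets the invariant class for products serve again. *)
rewrite -[f]mulr1 -[g]mulr1; apply: (smooth_coind sum_of_products_derive).
by apply: SumOfProductsD; exact: SumOfProductsM.
Qed.

Lemma smoothZ (c : R) f : smooth f -> smooth (c *: f).
Proof.
move=> sf; apply: (@smooth_coind [set g | exists2 h, smooth h & g = c *: h]); last by exists f.
move=> _ [h sh ->].
have d x : is_derive x 1 (c *: h) ((c *: (derive1 h)) x).
  by have dh := smooth_is_derive x sh; exact: is_deriveZ.
split; first by move=> x; have dx := d x; exact: ex_derive.
by exists (derive1 h); [exact: smooth_derive1|exact: derive1_ext].
Qed.

Lemma smooth_affine (c d : R) f : smooth f -> smooth (fun x => f (c * x + d)).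
Proof.
(* The factor [e] absorbs the powers of c produced by successive derivations. *)
move=> sf; apply: (@smooth_coind [set g | exists2 h : R -> R, smooth h &
   exists e : R, g = fun x => e * h (c * x + d)]); last first.
  by exists f => //; exists 1; apply/funext => x; rewrite mul1r.
move=> _ [h sh [e ->]].
have dd x : is_derive x 1 (fun x => e * h (c * x + d)) (e * c * (derive1 h) (c * x + d)).
  have du : is_derive x 1 (c *: id + cst d : R -> R) c.
    by apply: is_derive_eq; rewrite addr0 -[LHS]/(c * 1) mulr1.
  have dh := smooth_is_derive (c * x + d) sh.
  suff -> : e * c * derive1 h (c * x + d) = e *: (derive1 h (c * x + d) * c).
    exact: (is_deriveZ e (@is_derive1_comp _ h (c *: id + cst d : R -> R) x _ _ dh du)).
  by rewrite -[RHS]/(e * _); ring.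
split; first by move=> x; have dx := dd x; exact: ex_derive.
exists (derive1 h); first exact: smooth_derive1.
by exists (e * c); exact: derive1_ext.
Qed.

End Smooth.

(** * Smooth bump functions *)

Section Bump.
Context {R : realType}.
Implicit Types (p : {poly R}) (t x y e : R).

(** Induction on p: half of the rate e controls the smaller polynomial, the other half controls the
    new factor t, since 1 + x <= exp x gives t exp(- e t / 2) <= 2 / e. *)
Lemma horner_expR_bounded p e : 0 < e ->
  exists C, forall t, 0 < t -> `|p.[t]| * expR (- (e * t)) <= C.
Proof.
elim/poly_ind: p e => [|p c IH] e e0.
  by exists 0 => t _; rewrite horner0 normr0 mul0r.
have [C hC] := IH (e / 2) (divr_gt0 e0 (ltr0Sn _ 1)).
exists (C * (2 / e) + `|c|) => t t0; rewrite hornerMXaddC.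
have ex0 := expR_gt0 (- (e * t)).
apply: (@le_trans _ _ ((`|p.[t]| * t + `|c|) * expR (- (e * t)))).
  apply: ler_wpM2r; first exact: ltW.
  by apply: (le_trans (ler_normD _ _)); rewrite normrM (gtr0_norm t0).
rewrite mulrDl lerD//; last first.
  apply: ler_piMr => //; rewrite -[leRHS]expR0 ler_expR oppr_le0.
  by apply: mulr_ge0; exact: ltW.
have -> : expR (- (e * t)) = expR (- (e / 2 * t)) * expR (- (e / 2 * t)).
  by rewrite -expRD; congr expR; field.
have -> : `|p.[t]| * t * (expR (- (e / 2 * t)) * expR (- (e / 2 * t))) =
  (`|p.[t]| * expR (- (e / 2 * t))) * (t * expR (- (e / 2 * t))) by ring.
have h0 := mulr_ge0 (normr_ge0 p.[t]) (expR_ge0 (- (e / 2 * t))).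
have h1 := mulr_ge0 (ltW t0) (expR_ge0 (- (e / 2 * t))).
apply: (ler_pM h0 h1); first exact: hC.
rewrite expRN ler_pdivrMr ?expR_gt0//.
have := expR_ge1Dx (e / 2 * t).
move=> h; have : e / 2 * t <= expR (e / 2 * t) by lra.
move=> h'; have : 2 / e * (e / 2 * t) <= 2 / e * expR (e / 2 * t).
  by rewrite ler_pM2l ?divr_gt0.
by have -> : 2 / e * (e / 2 * t) = t by field; rewrite gt_eqF.
Qed.

(** The polynomial in 1/t is carried along because derivation changes nothing else: the derivative
    has the same shape with the polynomial X^2 (e p - p'), so one family contains all
    derivatives. *)
Definition flat e p t := if 0 < t then p.[t^-1] * expR (- (e * t^-1)) else 0.

Definition flat_deriv e p : {poly R} := 'X^2 * (e *: p - p^`()).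

Lemma is_derive_flat e p t : 0 < e ->
  is_derive t 1 (flat e p) (flat e (flat_deriv e p) t).
Proof.
move=> e0; have [t0|t0|t0] := ltgtP 0 t.
- have near_flat : \near t, p.[t^-1] * expR (- (e * t^-1)) = flat e p t.
    by near=> x; rewrite /flat ifT//; near: x; exact: lt_nbhsr.
  apply: (near_eq_is_derive near_flat).
  rewrite /flat t0 /flat_deriv.
  have tn0 : t != 0 by rewrite gt_eqF.
  have dV : is_derive t 1 (fun x : R => x^-1) (- t ^- 2).
    have := @is_deriveV _ id t 1 1 tn0 _; rewrite -[_ *: 1]/(_ * 1) mulr1; exact.
  have dp0 : is_derive t^-1 1 (horner p) (p^`()).[t^-1].
    have := derivableP (@derivable_horner _ p t^-1).
    by rewrite derivE derive1E.
  have dp := is_derive1_comp dp0 dV.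
  have de0 : is_derive t 1 (fun x : R => - (e * x^-1)) (- (e * - t ^- 2)).
    have := is_deriveN (is_deriveZ e dV); exact.
  have de := is_derive1_comp (is_derive_expR _) de0.
  have dpe := is_deriveM dp de.
  have -> : ('X^2 * (e *: p - p^`())).[t^-1] * expR (- (e * t^-1)) =
    p.[t^-1] *: (expR (- (e * t^-1)) * (- (e * - t ^- 2))) +
    expR (- (e * t^-1)) *: ((p^`()).[t^-1] * - t ^- 2).
    rewrite !hornerE; rewrite -[_ *: (_ * _)]/(_ * (_ * _)).
    rewrite -[expR _ *: _]/(_ * _) -exprVn; ring.
  exact: dpe.
- have near_flat : \near t, cst 0 t = flat e p t.
    near=> x; rewrite /flat ifF//; apply/negbTE; rewrite -leNgt; apply: ltW.
    by near: x; exact: lt_nbhsl.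
  apply: (near_eq_is_derive near_flat).
  by rewrite /flat ltNge (ltW t0)/=; exact: is_derive_cst.
- rewrite -t0 /flat ltxx.
  (* At 0 the difference quotient for h > 0 is h times the quantity bounded here; this is where the
     factor X^2 comes from. *)
  have [C hC] := horner_expR_bounded ('X^2 * p) e0.
  have C0 : 0 <= C.
    by apply: le_trans (hC 1 ltr01); exact: mulr_ge0 (normr_ge0 _) (expR_ge0 _).
  suff h : (fun h : R => h^-1 *: (flat e p (h + 0) - flat e p 0)) @ (0 : R)^' --> (0 : R).
    have h' : (fun h : R => h^-1 *: (flat e p (h *: (1 : R) + 0) - flat e p 0)) @ (0 : R)^' --> (0 : R).
      by under eq_fun do rewrite [_ *: 1]mulr1.
    apply: DeriveDef; first by apply/cvg_ex; exists 0.
    exact: cvg_lim h'.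
  apply/cvgrPdist_le => d d0.
  have dC : 0 < d / (C + 1) by rewrite divr_gt0// ltr_wpDl.
  near=> h; rewrite sub0r normrN addr0 {2}/flat ltxx subr0.
  rewrite -[h^-1 *: _]/(h^-1 * _).
  have hd : `|h| < d / (C + 1) by near: h; exact: dnbhs0_lt.
  rewrite /flat; case: ifPn => [h0|_]; last by rewrite mulr0 normr0 ltW.
  have hn0 : h != 0 by rewrite gt_eqF.
  have hV0 : 0 < h^-1 by rewrite invr_gt0.
  have := hC _ hV0; rewrite hornerM hornerXn normrM (ger0_norm (sqr_ge0 _)) => H.
  rewrite !normrM (gtr0_norm hV0) (gtr0_norm (expR_gt0 _)).
  rewrite gtr0_norm// in hd.
  have -> : h^-1 * (`|p.[h^-1]| * expR (- (e * h^-1))) =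
    h * (h^-1 ^+ 2 * `|p.[h^-1]| * expR (- (e * h^-1))) by field.
  apply: (@le_trans _ _ (h * C)); first by rewrite ler_pM2l.
  apply: (@le_trans _ _ (d / (C + 1) * (C + 1))).
    by apply: ler_pM => //; rewrite ?ltW// ltrDl.
  by rewrite divfK// gt_eqF// ltr_wpDl.
Unshelve. all: by end_near. Qed.

Lemma smooth_flat e p : 0 < e -> smooth (flat e p).
Proof.
move=> e0; apply: (@smooth_coind _ [set f | exists q, f = flat e q]); last by exists p.
move=> _ [q ->]; have d t := is_derive_flat q t e0.
split; first by move=> t; have dt := d t; exact: ex_derive.
by exists (flat_deriv e q); exact: derive1_ext.
Qed.

(* A smooth function with support [x, y]; as e decreases to 0 it converges to
   the indicator function of ]x, y[. *)
Definition bump e x y t := flat e 1 (t - x) * flat e 1 (y - t).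

Lemma smooth_bump e x y : 0 < e -> smooth (bump e x y).
Proof.
move=> e0; have sf : smooth (flat e 1) by exact: smooth_flat.
have -> : bump e x y = (fun t => flat e 1 (1 * t + - x)) * (fun t => flat e 1 (-1 * t + y)).
  apply/funext => t; rewrite -[RHS]/(flat e 1 _ * flat e 1 _) mul1r mulN1r.
  by rewrite [- t + y]addrC.
by apply: smoothM; exact: smooth_affine.
Qed.

Lemma bumpE e x y t : bump e x y t =
  if x < t < y then expR (- (e * ((t - x)^-1 + (y - t)^-1))) else 0.
Proof.
rewrite /bump /flat !hornerC !mul1r !subr_gt0.
case: (x < t) => /=; last by rewrite mul0r.
case: (t < y); last by rewrite mulr0.
by rewrite -expRD mulrDr opprD.
Qed.

Lemma bump_ge0 e x y t : 0 <= bump e x y t.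
Proof. by rewrite bumpE; case: ifP => // _; exact: expR_ge0. Qed.

Lemma bump_le1 e x y t : 0 < e -> bump e x y t <= 1.
Proof.
move=> e0; rewrite bumpE; case: ifP => // /andP[xt ty].
rewrite -expR0 ler_expR oppr_le0 mulr_ge0 ?ltW// addr_gt0// invr_gt0 subr_gt0//.
Qed.

End Bump.

(** * Test functions and orthogonality to them *)

Section DuBoisReymond.
Context {R : realType} (a b : R) (ab : a < b).
Implicit Types (f g h u v z phi : R -> R) (x y c d e : R).
Local Notation mu := (leb_itv a b).
Local Notation L2 := (L2 a b).
Local Notation ip := (ip a b).
Local Notation prim := (prim a b).
Local Notation test := (test_function a b).

Lemma bump_cvg x y t :
  (bump n.+1%:R^-1 x y t) @[n --> \oo] --> ((x < t < y)%R%:R : R).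
Proof.
have [xty|/negbTE xty] := boolP (x < t < y); under eq_fun do rewrite bumpE xty;
  last exact: cvg_cst.
have -> : (true%:R : R) = expR (- (0 * ((t - x)^-1 + (y - t)^-1))).
  by rewrite mul0r oppr0 expR0.
set K := (t - x)^-1 + _.
apply: (@continuous_cvg _ _ _ _ _ (fun n => - (n.+1%:R^-1 * K)) expR).
  exact: continuous_expR.
apply: cvgN; apply: cvgMr_tmp; exact: cvg_harmonic.
Qed.

Lemma L2_bump e x y : 0 < e -> L2 (bump e x y).
Proof. by move=> e0; apply: L2_continuous; exact/smooth_continuous/smooth_bump. Qed.

(** As e tends to 0, dominated convergence turns orthogonality to bumps into orthogonality to the
    indicators of ]x, y[. The primitive of z is then constant inside the interval, and zero by
    continuity at a. *)
Lemma bump_orth_ae0 z : L2 z ->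
  (forall x y e, a < x -> x < y -> y < b -> 0 < e -> ip z (bump e x y) = 0) ->
  z = 0 %[ae mu].
Proof.
move=> lz zb.
have mz := L2_measurable lz.
have key x y : a < x -> x < y -> y < b -> prim z y = prim z x.
  move=> ax xy yb.
  pose s t : R := (x < t < y)%R%:R.
  have zs : ip z s = 0.
    have nn n : 0 < n.+1%:R^-1 :> R by rewrite invr_gt0.
    have h : ((\int[mu]_t (z t * bump n.+1%:R^-1 x y t)%:E)%E @[n --> \oo] -->
              (\int[mu]_t (z t * s t)%:E)%E).
      apply: (@dominated_cvg _ _ _ mu setT measurableT
        (fun n t => (z t * bump n.+1%:R^-1 x y t)%:E) (fun t => (z t * s t)%:E)
        (fun t => `|z t|%:E)).
      - move=> n; apply/measurable_EFinP; apply: measurable_funM => //.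
        exact: L2_measurable (L2_bump x y (nn n)).
      - move=> t _; apply: cvg_EFin; first by near=> n.
        by apply: cvgMl_tmp; exact: bump_cvg.
      - by [].
      - by have := integrable_abse (L2_integrable lz); apply: eq_integrable.
      - move=> n t _; rewrite lee_fin normrM.
        rewrite (ger0_norm (bump_ge0 _ _ _ _)); apply: ler_piMr => //.
        exact: bump_le1.
    have h0 : ((\int[mu]_t (z t * bump n.+1%:R^-1 x y t)%:E)%E @[n --> \oo] --> (0 : \bar R)%E).
      have -> : (fun n => \int[mu]_t (z t * bump n.+1%:R^-1 x y t)%:E)%E = cst 0%E.
        apply/funext => n; rewrite -[LHS]fineK; last first.
          by apply: integrable_fin_num => //; exact: L2_mul_integrable lz (L2_bump x y (nn n)).
        by rewrite -[fine _]/(ip z (bump n.+1%:R^-1 x y)) zb.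
      exact: cvg_cst.
    by rewrite -[LHS]/(fine _) (cvg_unique (@ereal_hausdorff R) h h0).
  have ls : L2 s.
    apply: (@L2_bounded _ _ _ _ 1).
      have -> : s = \1_`]x, y[%classic.
        by apply/funext => t; rewrite indicE mem_setE in_itv.
      by apply: measurable_indic; exact: measurable_itv.
    by move=> t _; rewrite /s; case: (_ && _); rewrite ?normr1 ?normr0.
  apply/eqP; rewrite -subr_eq0 -[prim z y]/(ip _ _) -[prim z x]/(ip _ _).
  rewrite -ipBr//; try exact: L2_below.
  rewrite -zs; apply/eqP; apply: eq_ip => //; first by apply: L2B; exact: L2_below.
    by apply: ae_itv.
  apply: (ae_imply _ (atom_ae0 a b x)) => t tx _; rewrite below_subE ?(ltW xy)//.
  by rewrite /s le_eqVlt eq_sym (negbTE tx).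
have zc x : a < x -> x < b -> prim z x = 0.
  move=> ax xb.
  have h1 : prim z y @[y --> a^'+] --> prim z x.
    apply: cvg_near_cst; near=> y.
    have ay : a < y by near: y; exact: nbhs_right_gt.
    have yx : y < x by near: y; exact: nbhs_right_lt.
    by rewrite (key y x).
  have h2 : prim z y @[y --> a^'+] --> prim z a.
    by apply: cvg_at_right_filter; exact: prim_continuous.
  by rewrite (cvg_unique (@Rhausdorff R) h1 h2) // prim_left.
apply: prim_eq0_ae => // x.
have [xa|ax] := leP x a; first exact: prim_left.
have [xb|bx] := ltP x b; first exact: zc.
rewrite (prim_right lz bx) -(prim_right lz (lexx b)).
have h1 : prim z y @[y --> b^'-] --> (0 : R).
  apply: cvg_near_cst; near=> y; apply: zc; near: y.
    exact: nbhs_left_gt.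
  exact: nbhs_left_lt.
have h2 : prim z y @[y --> b^'-] --> prim z b.
  by apply: cvg_at_left_filter; exact: prim_continuous.
by rewrite (cvg_unique (@Rhausdorff R) h1 h2).
Unshelve. all: by end_near. Qed.

Lemma test_functionI c d phi : a < c -> d < b -> smooth phi ->
  (forall t, ~~ (c < t < d) -> phi t = 0) -> test phi.
Proof.
move=> ac db sphi phi0.
have scd : closure [set x | phi x != 0] `<=` `[c, d].
  rewrite [X in _ `<=` X](closure_id _).1; last exact: interval_closed.
  apply: closure_subset => x /= phix; rewrite in_itv/=; apply/negPn/negP => xcd.
  move: phix; rewrite phi0 ?eqxx//; apply: contra xcd => /andP[cx xd].
  by rewrite !ltW.
split => //.
- apply: subclosed_compact scd; [exact: closed_closure|exact: segment_compact].
- move=> t /scd; rewrite /= !in_itv/= => /andP[ct td].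
  by rewrite (lt_le_trans ac ct) (le_lt_trans td db).
Qed.

Lemma test_bump e x y : a < x -> y < b -> 0 < e -> test (bump e x y).
Proof.
move=> ax yb e0; apply: (test_functionI ax yb); first exact: smooth_bump.
by move=> t; rewrite bumpE => /negbTE ->.
Qed.

Lemma test_smooth phi : test phi -> smooth phi.
Proof. by case. Qed.

Lemma test_off phi x : test phi -> ~~ (a < x < b) -> phi x = 0.
Proof.
move=> [_ _ sphi] xab; apply/eqP; apply: contraNT xab => phix.
suff : `]a, b[%classic x by rewrite /= in_itv.
by apply: sphi; apply: subset_closure.
Qed.

Lemma test_L2 phi : test phi -> L2 phi.
Proof. by move=> /test_smooth/smooth_continuous; exact: L2_continuous. Qed.

Lemma C1_smooth phi : smooth phi -> C1 a b phi (derive1 phi).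
Proof.
move=> sphi; split; first exact: smooth_continuous.
  exact/smooth_continuous/smooth_derive1.
by move=> x _; exact: smooth_is_derive.
Qed.

Lemma test_derive1 phi : test phi -> test (derive1 phi).
Proof.
move=> tphi; have [sphi cphi iphi] := tphi.
have sub : closure [set x | derive1 phi x != 0] `<=` closure [set x | phi x != 0].
  rewrite [X in _ `<=` X](closure_id _).1; last exact: closed_closure.
  apply: closure_subset => x /= dx; apply: contrapT => nx.
  case/eqP: dx.
  have near0 : \near x, phi x = cst 0 x.
    have oC : open (~` closure [set x | phi x != 0]).
      by apply: closed_openC; exact: closed_closure.
    have := open_nbhs_nbhs (conj oC nx).
    apply: filterS => y ny; apply: contrapT => /eqP py; apply: ny.
    exact: subset_closure.
  rewrite derive1E (near_eq_derive _ near0)//; exact: derive_cst.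
split.
- exact: smooth_derive1.
- apply: subclosed_compact cphi sub; exact: closed_closure.
- exact: subset_trans iphi.
Qed.

Lemma test_derive1n phi k : test phi -> test (derive1n k phi).
Proof. by move=> tphi; elim: k => // k IH; rewrite derive1nS; exact: test_derive1. Qed.

Lemma prim_derive1_test phi : test phi -> ip (derive1 phi) (cst 1) = 0.
Proof.
move=> tphi; have cphi := C1_smooth (test_smooth tphi).
have [_ ld] := C1_L2 cphi.
rewrite -(prim_right ld (lexx b)) (FTC_C1 cphi) ?lexx ?(ltW ab)//.
by rewrite (test_off (x := b) tphi) ?(test_off (x := a) tphi) ?subrr ?ltxx ?andbF.
Qed.

Lemma ip_prim_test f phi (c : R) : L2 f -> test phi ->
  ip (prim f + cst c) (derive1 phi) = - ip f phi.
Proof.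
move=> lf tphi; have cphi := C1_smooth (test_smooth tphi).
have [lphi ld] := C1_L2 cphi.
have := ip_prim lf ld; rewrite prim_derive1_test// mulr0 => e.
rewrite (ipDl (L2_prim lf) (L2_cst a b c) ld).
have -> : cst c = c *: cst 1 :> (R -> R).
  by apply/funext => x; rewrite -[RHS]/(c * 1) mulr1.
rewrite ipZl//; last exact: L2_cst.
rewrite [ip (cst 1) _]ipC prim_derive1_test// mulr0 addr0.
apply/eqP; rewrite -addr_eq0 -e; apply/eqP; congr (_ + _).
apply: eq_ip => //; first exact: L2_prim.
- by apply: ae_itv.
- apply: ae_itv => x xab _; have /andP[ax xb] := xab.
  by rewrite (FTC_C1 cphi) ?(ltW ax) ?(ltW xb)// (test_off tphi (x := a)) ?subr0 ?ltxx.
Qed.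

End DuBoisReymond.

(** * Weak derivatives as iterated primitives *)

Section WeakDerivative.
Context {R : realType} (a b : R) (ab : a < b).
Implicit Types (f g h u v z phi : R -> R) (x y c d e : R) (r k : nat).
Local Notation mu := (leb_itv a b).
Local Notation L2 := (L2 a b).
Local Notation ip := (ip a b).
Local Notation prim := (prim a b).
Local Notation test := (test_function a b).

(** The primitive vanishes to the left of c by the support condition and to the right of d because f
    has mean zero. *)
Lemma prim_test f c d : a < c -> d < b -> smooth f ->
  (forall t, ~~ (c < t < d) -> f t = 0) -> ip f (cst 1) = 0 ->
  test (prim f) /\ derive1 (prim f) = f.
Proof.
move=> ac db sf f0 f1; have lf := L2_continuous a b (smooth_continuous sf).
have pc t : t <= c -> prim f t = 0.
  move=> tc; rewrite -[prim f t]/(\int[mu]_s _) -[RHS](ip0l a b (cst 1)).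
  apply: eq_Rintegral => s _; rewrite mul0r /below.
  case: ltP => [st|_]; last by rewrite mulr0.
  by rewrite f0 ?mul0r//; apply/negP => /andP[cs _]; lra.
have pd t : d <= t -> prim f t = 0.
  move=> dt; rewrite -[RHS]f1; apply: eq_Rintegral => s _ /=; rewrite /below.
  case: ltP => [//|ts]; rewrite f0 ?mul0r//.
  by apply/negP => /andP[_ sd]; lra.
have df x : is_derive x 1 (prim f) (f x).
  have [xc|cx] := ltP x c.
    rewrite f0; last by apply/negP => /andP[cx _]; lra.
    apply: (near_eq_is_derive _ (is_derive_cst (0 : R) x 1)).
    by near=> t; rewrite pc// ltW//; near: t; exact: lt_nbhsl.
  have [dx|xd] := ltP d x.
    rewrite f0; last by apply/negP => /andP[_ xd]; lra.
    apply: (near_eq_is_derive _ (is_derive_cst (0 : R) x 1)).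
    by near=> t; rewrite pd// ltW//; near: t; exact: lt_nbhsr.
  apply: is_derive_prim => //; first exact: smooth_continuous.
  by apply/andP; split; lra.
split; last exact: derive1_ext.
apply: (test_functionI ac db); first exact: (smoothP df sf).
move=> t; rewrite negb_and -!leNgt => /orP[tc|dt]; [exact: pc|exact: pd].
Unshelve. all: by end_near. Qed.

Lemma exists_bump_mass : exists x y e : R,
  [/\ a < x, y < b, 0 < e & ip (bump e x y) (cst 1) != 0].
Proof.
apply: contrapT => H.
have : ip (cst 1) (cst 1) = 0.
  apply: ip_ae0; first exact: L2_cst.
  apply: bump_orth_ae0 => //; first exact: L2_cst.
  move=> x y e ax xy yb e0; apply/eqP; apply: contrapT => /negP m0.
  by apply: H; exists x, y, e; rewrite ipC.
by move/eqP; rewrite ip_cst1// subr_eq0 gt_eqF.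
Qed.

(** The difference w = u - K f is orthogonal to all derivatives of test functions. Any bump, minus
    the multiple of one fixed bump that cancels its mean, is such a derivative; hence w minus a
    constant is orthogonal to every bump. *)
Lemma weak_primitive u f : L2 u -> L2 f ->
  (forall phi, test phi -> ip u (derive1 phi) = - ip f phi) ->
  exists c : R, u = prim f + cst c %[ae mu].
Proof.
move=> lu lf uf.
have lp := L2_prim lf.
pose w := u - prim f.
have lw : L2 w by exact: L2B.
have wphi phi : test phi -> ip w (derive1 phi) = 0.
  move=> tphi; have := ip_prim_test ab 0 lf tphi; rewrite addr0 => e.
  by rewrite ipBl// ?uf// ?e ?subrr//; exact/test_L2/test_derive1.
have [x0 [y0 [e1 [ax0 y0b e10 m0]]]] := exists_bump_mass.
have lchi : L2 (bump e1 x0 y0) by exact: L2_bump.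
(* The constant that makes w - c orthogonal to the fixed bump. *)
exists (ip w (bump e1 x0 y0) / ip (bump e1 x0 y0) (cst 1)).
set c := _ / _.
have lc := L2_cst a b c.
have lwc : L2 (w - cst c) by exact: L2B.
suff wc : w - cst c = 0 %[ae mu].
  apply: (ae_imply _ wc) => x /= wcx _; have := wcx I.
  rewrite -[(w - cst c) x]/(u x - prim f x - c) -[(prim f + cst c) x]/(prim f x + c).
  by move=> e; apply/eqP; rewrite -subr_eq0 opprD addrA; exact/eqP.
apply: bump_orth_ae0 => // x y e ax xy yb e0.
pose k := ip (bump e x y) (cst 1) / ip (bump e1 x0 y0) (cst 1).
have le : L2 (bump e x y) by exact: L2_bump.
have lt1 := L2_cst a b 1.
pose th := bump e x y - k *: bump e1 x0 y0.
have lk : L2 (k *: bump e1 x0 y0) by exact: L2Z.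
have [tp dp] : test (prim th) /\ derive1 (prim th) = th.
  apply: (@prim_test th (Num.min x x0) (Num.max y y0)).
  - by rewrite lt_min ax ax0.
  - by rewrite gt_max yb y0b.
  - rewrite /th -scaleNr; apply: smoothD; first exact: smooth_bump.
    by apply: smoothZ; exact: smooth_bump.
  - move=> t tn; rewrite -[th t]/(bump e x y t - k * bump e1 x0 y0 t) !bumpE.
    move: tn; rewrite gt_min lt_max.
    by case: (x < t); case: (t < y); case: (x0 < t); case: (t < y0) => //=;
      rewrite mulr0 subrr.
  - by rewrite ipBl// ipZl// /k divfK// subrr.
have := wphi _ tp; rewrite dp ipBr// ipZr// => /eqP.
rewrite subr_eq0 (ipBl lw lc le) => /eqP ->.
have -> : cst c = c *: cst 1 :> (R -> R).
  by apply/funext => t; rewrite -[RHS]/(c * 1) mulr1.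
rewrite ipZl// [ip (cst 1) _]ipC /k /c.
move: (ip w _) (ip (bump e x y) _) (ip (bump e1 x0 y0) _) => A B m; ring.
Qed.

(** An inductive substitute for u in H^r with r-th weak derivative g: each level exposes one
    intermediate derivative and one constant of integration. The two lemmas that follow give the
    equivalence. *)
Fixpoint is_prim r u g : Prop :=
  if r is r'.+1 then exists f, exists c : R,
    [/\ L2 f, is_prim r' f g & u = prim f + cst c %[ae mu]]
  else u = g %[ae mu].

Lemma weak_derivative_is_prim r u g : L2 g -> sobolevH r a b u ->
  weak_derivative a b r u g -> is_prim r u g.
Proof.
elim: r u => [|r IH] u lg [lu Hu] ug /=.
  have lug : L2 (u - g) by exact: L2B.
  suff uge : u - g = 0 %[ae mu].
    apply: (ae_imply _ uge) => x /= e _; apply/eqP; rewrite -subr_eq0.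
    by apply/eqP; exact: e.
  apply: bump_orth_ae0 => // x y e ax xy yb e0.
  have tb : test (bump e x y) by exact: test_bump.
  rewrite ipBl//; last exact: test_L2.
  have := ug _ tb; rewrite expr0 mul1r -[LHS]/(ip u (bump e x y)) => ->.
  exact: subrr.
have [f lf uf] := Hu 1%N isT.
have uf1 phi : test phi -> ip u (derive1 phi) = - ip f phi.
  by move=> tphi; have := uf phi tphi; rewrite expr1 mulN1r.
have shift k h : weak_derivative a b k.+1 u h -> weak_derivative a b k f h.
  move=> uh phi tphi; have := uh phi tphi.
  rewrite -[X in X = _]/(ip u (derive1 (derive1n k phi))) uf1; last exact: test_derive1n.
  by rewrite exprS mulN1r mulNr => /oppr_inj.
have [c uc] := weak_primitive lu lf uf1.
exists f, c; split => //; apply: IH => //; last exact: shift.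
split => // k kr; have [h lh uh] := Hu k.+1 kr; exists h => //; exact: shift.
Qed.

Lemma is_prim_weak_derivative r u g : L2 u -> L2 g -> is_prim r u g ->
  sobolevH r a b u /\ weak_derivative a b r u g.
Proof.
elim: r u => [|r IH] u lu lg /=.
  move=> ug; have w0 : weak_derivative a b 0 u g.
    move=> phi tphi; rewrite expr0 mul1r; have lphi := test_L2 tphi.
    by apply: eq_ip => //; exact: ae_itv.
  by split=> //; split=> // k; rewrite leqn0 => /eqP ->; exists g.
move=> [f [c [lf fg uf]]]; have [[_ Hf] wf] := IH f lf lg fg.
have lpc : L2 (prim f + cst c) by apply: L2D; [exact: L2_prim|exact: L2_cst].
have shift k h : weak_derivative a b k f h -> weak_derivative a b k.+1 u h.
  move=> fh phi tphi; have := fh phi tphi.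
  have td := test_derive1n k tphi.
  rewrite -[X in _ -> X = _]/(ip u (derive1 (derive1n k phi))).
  rewrite (eq_ip lu lpc _ _ uf (g' := derive1 (derive1n k phi))).
  - by rewrite ip_prim_test// exprS mulN1r mulNr -[ip f _]/(\int[mu]_x _) => ->.
  - exact/test_L2/test_derive1.
  - exact/test_L2/test_derive1.
  - exact: ae_itv.
split; last exact: shift.
split=> // -[_|k kr]; last by have [h lh fh] := Hf k kr; exists h => //; exact: shift.
by exists u => // phi tphi; rewrite expr0 mul1r.
Qed.

Definition Kprim r f : R -> R := iter r prim f.

(* pmon j is (x - a)^j / j! on [a, b]. *)
Definition pmon j : R -> R := Kprim j (cst 1).

Lemma Kprim_L2 r f : L2 f -> L2 (Kprim r f).
Proof. by move=> lf; elim: r => //= r IH; exact: L2_prim. Qed.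

Lemma L2_pmon j : L2 (pmon j).
Proof. exact/Kprim_L2/L2_cst. Qed.

Lemma eq_prim f g : L2 f -> L2 g -> f = g %[ae mu] -> prim f = prim g.
Proof.
move=> lf lg fg; apply/funext => x; apply: eq_ip => //; [exact: L2_below..|].
exact: ae_itv.
Qed.

Lemma prim_sum n (c : 'I_n -> R) (e : 'I_n -> R -> R) : (forall i, L2 (e i)) ->
  prim (\sum_i c i *: e i) = \sum_i c i *: prim (e i).
Proof.
move=> le; apply/funext => x; rewrite lincombE.
by rewrite -[LHS]/(ip _ _) ip_suml//; exact: L2_below.
Qed.

(** One more primitive sends [pmon j] to [pmon j.+1], so the old coefficients move up one index and
    the new constant of integration takes index 0. *)
Lemma is_primP r u g : L2 u -> L2 g -> is_prim r u g <->
  exists c : 'I_r -> R, u = Kprim r g + \sum_j c j *: pmon j %[ae mu].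
Proof.
move=> lu lg; elim: r u lu => [|r IH] u lu /=.
  split => [ug|[c]]; last by rewrite big_ord0 addr0.
  by exists (fun=> 0); rewrite big_ord0 addr0.
have expand (c : 'I_r -> R) (c0 : R) (c' : 'I_r.+1 -> R) :
    c' ord0 = c0 -> (forall j, c' (lift ord0 j) = c j) ->
    prim (Kprim r g + \sum_j c j *: pmon j) + cst c0 =
    Kprim r.+1 g + \sum_j c' j *: pmon j.
  move=> h0 hS; have lsum := L2_sum c (fun j => L2_pmon (nat_of_ord j)).
  rewrite big_ord_recl h0 (_ : prim (_ + _) = prim (Kprim r g) + prim (\sum_j c j *: pmon j)).
    rewrite prim_sum; last by move=> j; exact: L2_pmon.
    rewrite -addrA; congr (_ + _); rewrite addrC; congr (_ + _).
      by apply/funext => x; rewrite -[RHS]/(c0 * 1) mulr1.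
    by apply: eq_bigr => j _; rewrite hS.
  by apply/funext => x; apply: primD => //; exact: Kprim_L2.
have lE (c : 'I_r -> R) : L2 (Kprim r g + \sum_j c j *: pmon j).
  by apply: L2D; [exact: Kprim_L2|exact: L2_sum (fun j => L2_pmon (nat_of_ord j))].
split=> [[f [c0 [lf fg uf]]]|[c uc]].
  have [c fc] := (IH f lf).1 fg.
  exists (fun j => if unlift ord0 j is Some i then c i else c0).
  rewrite -(expand c c0) ?unlift_none// => [|j]; last by rewrite liftK.
  by rewrite -(eq_prim lf (lE c) fc).
exists (Kprim r g + \sum_j c (lift ord0 j) *: pmon j), (c ord0); split => //.
  by apply/(IH _ (lE _)); exists (fun j => c (lift ord0 j)); exact: ae_itv.
by rewrite (expand _ _ c).
Qed.

End WeakDerivative.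

(** * Orthonormal families and projections *)

Section Orthonormal.
Context {R : realType} (a b : R) (ab : a < b).
Implicit Types (f g h u v z : R -> R).
Local Notation mu := (leb_itv a b).
Local Notation L2 := (L2 a b).
Local Notation ip := (ip a b).
Local Notation trig := (trig a b).
Local Notation L2norm := (L2norm a b).

(** There are n linear conditions on n + 1 coefficients, and a nonzero coefficient vector gives a
    function of positive norm because the cosines are orthogonal and non-null. *)
Lemma exists_trig_orth n (e : 'I_n -> R -> R) : (forall i, L2 (e i)) ->
  exists c : 'I_n.+1 -> R, let v := \sum_k c k *: trig k 0 in
    0 < ip v v /\ forall i, ip v (e i) = 0.
Proof.
move=> le; pose A : 'M[R]_(n.+1, n) := \matrix_(k, i) ip (trig k 0) (e i).
have [u u0 uA] := exists_left_kernel A (ltnSn n).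
have lt (k : 'I_n.+1) : L2 (trig k 0) by exact: L2_trig.
exists (u 0); split.
  rewrite ip_sum_orth//; last by move=> i j ij; exact: ip_trig_orth.
  rewrite lt_neqAle sumr_ge0 ?andbT; last by move=> k _; rewrite mulr_ge0 ?sqr_ge0 ?ip_ge0.
  apply: contra u0 => /eqP /esym s0; apply/eqP/rowP => k; rewrite mxE.
  have /eqP : u 0 k ^+ 2 * ip (trig k 0) (trig k 0) = 0.
    by apply: (psumr_eq0P _ s0) => // i _; rewrite mulr_ge0 ?sqr_ge0 ?ip_ge0.
  rewrite mulf_eq0 sqrf_eq0 => /orP[/eqP//|].
  by rewrite gt_eqF// ip_trig_gt0// orbT.
move=> i; rewrite ip_suml//; have := congr1 (fun M : 'rV_n => M 0 i) uA.
by rewrite !mxE => s0; rewrite -[RHS]s0; apply: eq_bigr => k _; rewrite !mxE.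
Qed.

Definition orthonormal n (e : 'I_n -> R -> R) :=
  (forall i, L2 (e i)) /\ (forall i j, ip (e i) (e j) = (i == j)%:R).

Definition proj n (e : 'I_n -> R -> R) f : R -> R := \sum_i ip f (e i) *: e i.

Section Projection.
Context n (e : 'I_n -> R -> R).
Hypothesis one : orthonormal e.
Let le : forall i, L2 (e i) := one.1.
Let ee : forall i j, ip (e i) (e j) = (i == j)%:R := one.2.

Lemma L2_proj f : L2 (proj e f).
Proof. exact: L2_sum. Qed.

Lemma ip_lincomb_orthonormal (c : 'I_n -> R) i : ip (\sum_j c j *: e j) (e i) = c i.
Proof.
rewrite ip_suml// (bigD1 i)//= ee eqxx mulr1 big1 ?addr0// => j ji.
by rewrite ee (negbTE ji) mulr0.
Qed.

Lemma ip_projB f i : L2 f -> ip (f - proj e f) (e i) = 0.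
Proof. by move=> lf; rewrite ipBl ?ip_lincomb_orthonormal ?subrr//; exact: L2_proj. Qed.

Lemma ip_projB_lincomb f (c : 'I_n -> R) : L2 f ->
  ip (f - proj e f) (\sum_i c i *: e i) = 0.
Proof.
move=> lf; have lp := L2B lf (L2_proj f).
by rewrite ip_sumr// big1// => i _; rewrite ip_projB ?mulr0.
Qed.

(** Pythagoras: the two differences differ by an element of the span, which is orthogonal to f -
    [proj e f]. *)
Lemma proj_min f (c : 'I_n -> R) : L2 f ->
  L2norm (f - proj e f) <= L2norm (f - \sum_i c i *: e i).
Proof.
move=> lf; have ls := L2_sum c le; have lp := L2B lf (L2_proj f).
rewrite -(ler_pXn2r (n := 2))// ?nnegrE ?L2norm_ge0// !L2norm_sqr//; last exact: L2B.
pose d i := ip f (e i) - c i.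
have ld := L2_sum d le.
have -> : f - \sum_i c i *: e i = (f - proj e f) + \sum_i d i *: e i.
  apply/funext => x; rewrite -[LHS]/(f x - (\sum_i c i *: e i) x).
  rewrite -[RHS]/(f x - proj e f x + (\sum_i d i *: e i) x) /proj !lincombE.
  rewrite -addrA; congr (_ + _); rewrite -!sumrN -big_split; apply: eq_bigr => i _ /=.
  by rewrite /d; ring.
rewrite (ipDl lp ld (L2D lp ld)) (ipDr lp lp ld) (ipDr ld lp ld).
rewrite ip_projB_lincomb// [ip (\sum_i _) _]ipC ip_projB_lincomb//.
by rewrite addr0 add0r lerDl ip_ge0.
Qed.

Lemma orthonormal_free (c : 'I_n -> R) : \sum_i c i *: e i = 0 %[ae mu] ->
  forall i, c i = 0.
Proof.
move=> c0 i; rewrite -(ip_lincomb_orthonormal c i) -(ip0l a b (e i)).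
apply: eq_ip => //; [exact: L2_sum|by have [] := L2_submod_closed a b|].
exact: ae_itv.
Qed.

Lemma span_proj f (c : 'I_n -> R) : L2 f -> f = \sum_i c i *: e i %[ae mu] ->
  f = proj e f %[ae mu].
Proof.
move=> lf fc; suff -> : proj e f = \sum_i c i *: e i by [].
apply: eq_bigr => i _; congr (_ *: _); rewrite -[RHS](ip_lincomb_orthonormal c i).
by apply: eq_ip => //; [exact: L2_sum|exact: ae_itv].
Qed.

Lemma ip_span0 f z : L2 f -> L2 z -> f = proj e f %[ae mu] ->
  (forall i, ip z (e i) = 0) -> ip z f = 0.
Proof.
move=> lf lz fp z0; rewrite (eq_ip lz lz lf (L2_proj f) _ fp); last exact: ae_itv.
by rewrite ip_sumr// big1// => i _; rewrite z0 mulr0.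
Qed.

End Projection.

Lemma span_lincomb n (e : 'I_n -> R -> R) m (f : 'I_m -> R -> R) (c : 'I_m -> R) :
  orthonormal e -> (forall j, L2 (f j)) -> (forall j, f j = proj e (f j) %[ae mu]) ->
  \sum_j c j *: f j = proj e (\sum_j c j *: f j) %[ae mu].
Proof.
move=> [le _] lf fe; apply: (ae_imply _ (ae_forall_ord fe)) => x fx _.
rewrite -[RHS]/((\sum_i ip (\sum_j c j *: f j) (e i) *: e i) x) !lincombE.
under eq_bigr do rewrite fx// /proj lincombE mulr_sumr.
rewrite exchange_big /=; apply: eq_bigr => i _.
by rewrite ip_suml// mulr_suml; apply: eq_bigr => j _; rewrite mulrA.
Qed.

Lemma proj_min_span n (e : 'I_n -> R -> R) f z : orthonormal e -> L2 f -> L2 z ->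
  z = proj e z %[ae mu] -> L2norm (f - proj e f) <= L2norm (f - z).
Proof.
move=> one lf lz zp; have := proj_min one (fun i => ip z (e i)) lf.
rewrite -[\sum_i _]/(proj e z); congr (_ <= _); apply: eq_L2norm.
- by apply: L2B => //; exact: L2_proj.
- exact: L2B.
- by apply: (ae_imply _ zp) => x h _; rewrite -[RHS]/(f x - z x) h.
Qed.

Lemma orthonormal_norm n (e : 'I_n -> R -> R) i : orthonormal e -> L2norm (e i) = 1.
Proof. by move=> [le ee]; rewrite L2normE// ee eqxx sqrtr1. Qed.

Lemma eq_proj n (e : 'I_n -> R -> R) f g : orthonormal e -> L2 f -> L2 g ->
  f = g %[ae mu] -> proj e f = proj e g.
Proof.
move=> [le _] lf lg fg; apply: eq_bigr => i _; congr (_ *: _).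
by apply: eq_ip => //; exact: ae_itv.
Qed.

Lemma continuous_lincomb n (c : 'I_n -> R) (e : 'I_n -> R -> R) :
  (forall i, continuous (e i)) -> continuous (\sum_i c i *: e i).
Proof.
move=> ce x; elim/big_ind: _ => [|f g cf cg|i _]; first exact: cst_continuous.
  exact: continuousD.
by apply: continuousZr; exact: ce.
Qed.

(* If f is linearly dependent, e is completed by combinations of cosines, so that
   it remains continuous. *)
Lemma exists_orthonormal n (f : 'I_n -> R -> R) : (forall i, L2 (f i)) ->
  exists e : 'I_n -> R -> R, [/\ orthonormal e,
    forall i, f i = proj e (f i) %[ae mu] &
    (forall i, continuous (f i)) -> forall i, continuous (e i)].
Proof.
elim: n f => [|n IH] f lf.
  by exists (fun=> 0); split => [|[]|_ []]//; split=> -[].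
have [e' [one' fe' ce']] := IH (fun i => f (lift ord0 i)) (fun i => lf _).
have [le' ee'] := one'.
pose rho := f ord0 - proj e' (f ord0).
have lrho : L2 rho by apply: L2B => //; exact: L2_proj.
have [v [s [lv v0 ve' fv cv]]] : exists v, exists s : R, [/\ L2 v, 0 < ip v v,
    forall i, ip v (e' i) = 0, rho = s *: v %[ae mu] &
    (forall i, continuous (f i)) -> continuous v].
  have [r0|rn0] := eqVneq (ip rho rho) 0.
    have [c [v0 vc]] := exists_trig_orth le'.
    have lt (k : 'I_n.+1) : L2 (trig k 0) by exact: L2_trig.
    exists (\sum_k c k *: trig k 0), 0; split => //; first exact: L2_sum.
      by rewrite scale0r; exact: ip_eq0.
    by move=> _; apply: continuous_lincomb => k; have [] := C1_trig a b k 0.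
  exists rho, 1; split => //.
  - by rewrite lt_neqAle eq_sym rn0 ip_ge0.
  - by move=> i; exact: ip_projB.
  - by rewrite scale1r; exact: ae_itv.
  - move=> cf x; apply: continuousB; first exact: cf.
    by apply: continuous_lincomb; apply: ce' => i; exact: cf.
pose e0 := (Num.sqrt (ip v v))^-1 *: v.
have sv0 : 0 < Num.sqrt (ip v v) by rewrite sqrtr_gt0.
have le0 : L2 e0 by exact: L2Z.
have e00 : ip e0 e0 = 1.
  rewrite ipZl// ipZr// mulrA -expr2 exprVn sqr_sqrtr ?ltW// mulVf// gt_eqF//.
have e0e' i : ip e0 (e' i) = 0 by rewrite ipZl// ve' mulr0.
pose e (j : 'I_n.+1) := if unlift ord0 j is Some i then e' i else e0.
have eS i : e (lift ord0 i) = e' i by rewrite /e liftK.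
have e0E : e ord0 = e0 by rewrite /e unlift_none.
have one : orthonormal e.
  split=> [j|j k]; first by case: (unliftP ord0 j) => [i ->|->]; rewrite ?eS ?e0E.
  case: (unliftP ord0 j) => [i ->|->]; case: (unliftP ord0 k) => [l ->|->];
    rewrite ?eS ?e0E.
  - by rewrite ee' (inj_eq lift_inj).
  - by rewrite ipC e0e' eq_sym (negbTE (neq_lift _ _)).
  - by rewrite e0e' (negbTE (neq_lift _ _)).
  - by rewrite e00 eqxx.
exists e; split => //.
- move=> j; case: (unliftP ord0 j) => [i ->|->].
    apply: (span_proj one (c := fun j => if unlift ord0 j is Some l then ip (f (lift ord0 i)) (e' l) else 0)) => //.
    rewrite big_ord_recl unlift_none scale0r add0r.
    by under eq_bigr do rewrite liftK eS; exact: fe'.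
  apply: (span_proj one (c := fun j => if unlift ord0 j is Some l then ip (f ord0) (e' l) else s * Num.sqrt (ip v v))) => //.
  rewrite big_ord_recl unlift_none e0E.
  under eq_bigr do rewrite liftK eS.
  apply: (ae_imply _ fv) => x h _.
  have {}h : f ord0 x - proj e' (f ord0) x = s * v x := h I.
  rewrite -[LHS](subrK (proj e' (f ord0) x)) h.
  rewrite -[RHS]/(s * Num.sqrt (ip v v) * ((Num.sqrt (ip v v))^-1 * v x) + proj e' (f ord0) x).
  by rewrite mulrA mulfK ?gt_eqF.
- move=> cf j; case: (unliftP ord0 j) => [i ->|->].
    by rewrite eS; apply: ce' => l; exact: cf.
  by rewrite e0E => x; apply: continuousZr; exact: cv.
Qed.

End Orthonormal.

(** * The width in terms of projections, and its lower bound *)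

Section Width.
Context {R : realType} (a b : R) (ab : a < b).
Implicit Types (f g h u v z : R -> R) (C : R) (r n : nat).
Local Notation mu := (leb_itv a b).
Local Notation L2 := (L2 a b).
Local Notation ip := (ip a b).
Local Notation prim := (prim a b).
Local Notation trig := (trig a b).
Local Notation freq := (freq a b).
Local Notation L2norm := (L2norm a b).
Local Notation proj := (proj a b).
Local Notation orthonormal := (orthonormal a b).
Local Notation is_prim := (is_prim a b).

(** The working form of [width_constants]: an orthonormal basis stands for the subspace, the
    projection for the minimum, and [is_prim] for the weak derivative. *)
Definition width_bound r n C := exists2 e : 'I_n -> R -> R, orthonormal e &
  forall u g, L2 u -> L2 g -> is_prim r u g ->
    L2norm (u - proj e u) <= C * L2norm g.

Lemma width_boundP r n C : width_constants a b r n C <-> width_bound r n C.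
Proof.
split=> [[X [f [lf _ ->] Xmin]]|[e one Hu0]].
  have [e [one fe _]] := exists_orthonormal ab lf; have [le _] := one.
  exists e => // u g lu lg ug.
  have [Hu wu] := is_prim_weak_derivative ab lu lg ug.
  have [m [[v [lv [c vc]] <-] _] mC] := Xmin u g Hu lg wu.
  apply: le_trans mC.
  apply: proj_min_span => //.
  have ls := L2_sum c lf.
  rewrite (eq_proj one lv ls vc).
  by apply: (ae_imply2 _ vc (span_lincomb c one lf fe)) => x h1 h2 _; rewrite h1// h2.
have [le _] := one.
exists [set v | L2 v /\ exists c : 'I_n -> R, v = \sum_i c i *: e i %[ae mu]].
  by exists e; split => //; exact: orthonormal_free.
move=> u g Hu lg wu; have [lu _] := Hu.
exists (L2norm (u - proj e u)); last first.
  by apply: Hu0 => //; exact: weak_derivative_is_prim.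
split.
  exists (proj e u) => //; split; first exact: L2_proj.
  by exists (fun i => ip u (e i)); exact: ae_itv.
move=> _ [v [lv [c vc]] <-]; apply: proj_min_span => //.
exact: (span_proj one lv vc).
Qed.

Lemma width_bound_le r n C C' : C <= C' -> width_bound r n C -> width_bound r n C'.
Proof.
move=> CC' [e one He]; exists e => // u g lu lg ug.
by apply: (le_trans (He u g lu lg ug)); rewrite ler_wpM2r ?L2norm_ge0.
Qed.

Lemma C1_is_prim v f : C1 a b v f -> v = prim f + cst (v a) %[ae mu].
Proof.
move=> vf; apply: ae_itv => x /andP[ax xb] _.
by rewrite -[RHS]/(prim f x + v a) (FTC_C1 vf) ?subrK// !ltW.
Qed.

Lemma is_prim_trig r n (c : 'I_n -> R) j :
  is_prim r (\sum_k c k *: trig k j) (\sum_k c k *: (freq k ^+ r *: trig k (j + r))).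
Proof.
elim: r j c => [|r IH] j c /=.
  apply: ae_itv => x _ _; rewrite !lincombE; apply: eq_bigr => k _.
  by rewrite expr0 scale1r addn0.
exists (\sum_k (c k * freq k) *: trig k j.+1), ((\sum_k c k *: trig k j) a); split.
- by apply: L2_sum => k; exact: L2_trig.
- have := IH j.+1 (fun k => c k * freq k); rewrite addSnnS.
  congr (is_prim _ _ _); apply: eq_bigr => k _.
  by rewrite exprS !scalerA -mulrA.
- apply: C1_is_prim.
  have -> : \sum_k (c k * freq k) *: trig k j.+1 = \sum_k c k *: (freq k *: trig k j.+1).
    by apply: eq_bigr => k _; rewrite scalerA.
  by apply: C1_sum => k; exact: C1_trig.
Qed.

Lemma width_bound_ge r n C : (0 < r)%N -> width_bound r n C ->
  1 <= C * freq n ^+ r.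
Proof.
move=> r0 [e one He]; have [le _] := one.
have [c [v0 ve]] := exists_trig_orth ab le.
set v := \sum_k _ in v0 ve.
have lt (k j : nat) : L2 (trig k j) by exact: L2_trig.
have lv : L2 v by exact: L2_sum.
pose g := \sum_k c k *: (freq k ^+ r *: trig k r).
have lg : L2 g by apply: L2_sum => k; exact: L2Z.
have := He v g lv lg (is_prim_trig r c 0).
have -> : proj e v = 0.
  by rewrite -[LHS]/(\sum_i _ *: _) big1// => i _; rewrite ve scale0r.
rewrite subr0.
have gv : L2norm g <= freq n ^+ r * L2norm v.
  have fn0 := exprn_ge0 r (freq_ge0 ab n).
  rewrite -(ler_pXn2r (n := 2))// ?nnegrE ?mulr_ge0 ?L2norm_ge0// exprMn !L2norm_sqr//.
  rewrite ip_sum_orth//; last 2 first.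
  - by move=> k; exact: L2Z.
  - by move=> k l kl; rewrite ipZl ?ipZr ?ip_trig_orth ?mulr0//; exact: L2Z.
  rewrite /v ip_sum_orth//; last by move=> k l kl; exact: ip_trig_orth.
  rewrite mulr_sumr; apply: ler_sum => k _.
  rewrite ipZl ?ipZr//; last exact: L2Z.
  (* Frequency 0 is set apart: [ip_trig_sqr] excludes it, but the factor [freq 0 ^+ r] vanishes
     since r > 0. *)
  have [k0|k0] := posnP k.
    rewrite k0 freq0 expr0n gtn_eqF//= !mul0r mulr0.
    by apply: mulr_ge0; [exact: sqr_ge0|apply: mulr_ge0; [exact: sqr_ge0|exact: ip_ge0]].
  rewrite !(ip_trig_sqr ab _ k0) [leRHS]mulrCA ler_wpM2l ?sqr_ge0//.
  rewrite mulrA -expr2 ler_wpM2r ?divr_ge0 ?subr_ge0 ?(ltW ab)//.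
  rewrite ler_pXn2r ?nnegrE ?exprn_ge0 ?freq_ge0//.
  rewrite ler_pXn2r ?nnegrE ?freq_ge0//.
  have := ltn_ord k; rewrite ltnS leq_eqVlt => /predU1P[->//|kn].
  exact: ltW (freq_lt ab kn).
have Nv : 0 < L2norm v by rewrite L2normE// sqrtr_gt0.
have Ng := L2norm_ge0 a b g.
move=> H.
have C0 : 0 < C.
  rewrite ltNge; apply/negP => C0.
  by have := mulr_le0_ge0 C0 Ng; lra.
have : L2norm v <= C * freq n ^+ r * L2norm v.
  by apply: (le_trans H); rewrite -mulrA ler_pM2l.
by rewrite -{1}[L2norm v]mul1r ler_pM2r.
Qed.

End Width.

(** * The upper bound for the width *)

Section UpperBound.
Context {R : realType} (a b : R) (ab : a < b).
Implicit Types (f g h u v z : R -> R) (C : R) (r n : nat).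
Local Notation L2 := (L2 a b).
Local Notation ip := (ip a b).
Local Notation prim := (prim a b).
Local Notation trig := (trig a b).
Local Notation freq := (freq a b).
Local Notation L2norm := (L2norm a b).
Local Notation proj := (proj a b).
Local Notation pmon := (pmon a b).
Local Notation Kprim := (Kprim a b).

(** Two more phases only change the sign, so orthogonality depends on the parity of the phase. *)
Lemma ip_trig_parity v k j : L2 v -> ip v (trig k j) = 0 -> ip v (trig k (odd j)) = 0.
Proof.
move=> lv; have lt i : L2 (trig k i) by exact: L2_trig.
have shift i : ip v (trig k i.+2) = - ip v (trig k i).
  have -> : trig k i.+2 = (-1) *: trig k i.
    by apply/funext => x; rewrite trigSS -[RHS]/(-1 * _) mulN1r.
  by rewrite ipZr// mulN1r.
have [l] := ubnP j; elim: l j => // l IH [|[|j]]//; rewrite ltnS => jl.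
rewrite shift => /eqP; rewrite oppr_eq0 => /eqP h.
by rewrite /= negbK; apply: IH => //; apply: leq_trans jl.
Qed.

Lemma continuous_Kprim r g : (0 < r)%N -> L2 g -> continuous (Kprim r g).
Proof. by case: r => // r _ lg; apply: prim_continuous; exact: Kprim_L2. Qed.

Lemma continuous_pmon j : continuous (pmon j).
Proof.
case: j => [x|j]; first exact: cst_continuous.
by apply: continuous_Kprim => //; exact: L2_cst.
Qed.

Lemma continuous_Kprim_continuous r g : continuous g -> continuous (Kprim r g).
Proof.
by case: r => // r cg; apply: continuous_Kprim => //; exact: L2_continuous.
Qed.

Section IteratedPrimitive.
Variables (r : nat) (y : R -> R).
Hypothesis ly : L2 y.
Hypothesis yp : forall j, (j < r)%N -> ip y (pmon j) = 0.
Let W i := Kprim i y.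

Let lW i : L2 (W i).
Proof. exact: Kprim_L2. Qed.

(** In [ip_prim] the right-hand side vanishes as long as [W i] is orthogonal to constants; each
    primitive then costs one degree. *)
Lemma Kprim_orth_pmon i j : (i + j < r)%N -> ip (W i) (pmon j) = 0.
Proof.
elim: i j => [|i IH] j; first exact: yp.
rewrite addSnnS => ijr; have := ip_prim (lW i) (L2_pmon a b j).
rewrite -[cst 1]/(pmon 0) (IH 0%N) ?mul0r; last first.
  by rewrite addn0 (leq_ltn_trans _ ijr)// leq_addr.
by rewrite -[prim (pmon j)]/(pmon j.+1) IH ?addr0.
Qed.

(** Each primitive moved from g to y changes the sign; the product of means in [ip_prim] is zero
    because [W i] is orthogonal to constants for i < r. *)
Lemma ip_Kprim g i : L2 g -> (i <= r)%N ->
  ip (Kprim r g) y = (-1) ^+ i * ip (Kprim (r - i) g) (W i).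
Proof.
move=> lg; elim: i => [|i IH] ir; first by rewrite subn0 expr0 mul1r.
rewrite IH; last exact: ltnW.
have := ip_prim (Kprim_L2 (r - i.+1) lg) (lW i).
have -> : ip (W i) (cst 1) = 0 by apply: (Kprim_orth_pmon (j := 0)); rewrite addn0.
rewrite mulr0.
have -> : prim (Kprim (r - i.+1) g) = Kprim (r - i) g.
  by rewrite -[LHS]/(Kprim (r - i.+1).+1 g) subnSK.
rewrite -[prim (W i)]/(W i.+1) => /eqP; rewrite addr_eq0 => /eqP ->.
by rewrite exprS mulN1r mulrN mulNr.
Qed.

End IteratedPrimitive.

Section IteratedWirtinger.
Variables (r m : nat) (y : R -> R).
Hypothesis m0 : (0 < m)%N.
Hypothesis cy : continuous y.
Hypothesis yp : forall j, (j < r)%N -> ip y (pmon j) = 0.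
Hypothesis yt : forall k, (0 < k < m)%N -> ip y (trig k (~~ odd r)) = 0.
Let W i := Kprim i y.

Let ly : L2 y.
Proof. exact: L2_continuous. Qed.

Let lW i : L2 (W i).
Proof. exact: Kprim_L2. Qed.

Let C1W i : C1 a b (W i.+1) (W i).
Proof. by apply: C1_prim; exact: continuous_Kprim_continuous. Qed.

Lemma Kprim_right i : (i < r)%N -> W i.+1 b = 0.
Proof.
move=> ir; rewrite [LHS]prim_right//.
by apply: (Kprim_orth_pmon ly yp (j := 0)); rewrite addn0.
Qed.

Lemma Kprim_left i : W i.+1 a = 0.
Proof. exact: prim_left. Qed.

(** Integration by parts raises the phase by one. The boundary terms vanish since [W i.+1] is zero
    at both ends, and the factor [freq k] is cancelled since k > 0. *)
Lemma Kprim_orth_trig i k : (i <= r)%N -> (0 < k < m)%N ->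
  ip (W i) (trig k (~~ odd r + i)) = 0.
Proof.
elim: i => [|i IH] ir km; first by rewrite addn0 yt.
have := ip_by_parts ab (C1W i) (C1_trig a b k (~~ odd r + i)).
rewrite IH//; last exact: ltnW.
rewrite Kprim_right// Kprim_left !mul0r subrr add0r ipZr//; last exact: L2_trig.
move/eqP; rewrite mulf_eq0 => /orP[|/eqP]; last by rewrite addnS.
have /andP[k0 _] := km.
by rewrite -(freq0 a b) => /eqP /(freq_inj ab) e; rewrite e in k0.
Qed.

(** The steps alternate between the sine and the cosine version of [wirtinger]. The cosine version
    also asks for orthogonality to constants, which is available for [W i.+1] when i + 1 < r; the
    initial phase [~~ odd r] makes the last step, i + 1 = r, a sine step, which relies on the zeros
    at a and b instead. *)
Lemma Kprim_wirtinger i : (i < r)%N ->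
  freq m ^+ 2 * ip (W i.+1) (W i.+1) <= ip (W i) (W i).
Proof.
move=> ir; apply: (wirtinger ab (s := odd (~~ odd r + i.+1))) => //.
- by case: (odd _).
- by move=> _; rewrite Kprim_right// Kprim_left.
move=> [|k] km; last first.
  by apply: ip_trig_parity => //; apply: Kprim_orth_trig.
case: (boolP (odd (~~ odd r + i.+1))) => [_|ev].
  have -> : trig 0 true = 0.
    by apply/funext => x; rewrite -[LHS]/(cos _) freq0 mul0r add0r mul1r cos_pihalf.
  by rewrite ipC ip0l.
have -> : trig 0 false = pmon 0.
  by apply/funext => x; rewrite -[LHS]/(cos _) freq0 !mul0r addr0 cos0.
apply: (Kprim_orth_pmon ly yp); rewrite addn0 ltn_neqAle ir andbT.
by apply: contra ev => /eqP ->; rewrite oddD; case: (odd r).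
Qed.

Lemma Kprim_norm_le i : (i <= r)%N -> freq m ^+ i * L2norm (W i) <= L2norm y.
Proof.
elim: i => [|i IH] ir; first by rewrite expr0 mul1r.
apply: le_trans (IH (ltnW ir)).
have f0 := freq_ge0 ab m.
rewrite exprSr -mulrA ler_wpM2l ?exprn_ge0//.
rewrite -(ler_pXn2r (n := 2))// ?nnegrE ?(mulr_ge0 f0) ?L2norm_ge0//.
by rewrite exprMn !L2norm_sqr//; exact: Kprim_wirtinger.
Qed.

Lemma ip_Kprim_le g : L2 g ->
  freq m ^+ r * `|ip (Kprim r g) y| <= L2norm g * L2norm y.
Proof.
move=> lg; rewrite (ip_Kprim ly yp lg (leqnn r)) subnn normrM normrX normrN1 expr1n mul1r.
apply: (@le_trans _ _ (freq m ^+ r * (L2norm g * L2norm (W r)))).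
  by rewrite ler_wpM2l ?exprn_ge0 ?freq_ge0//; exact: (normr_ip_le lg (lW r)).
by rewrite mulrCA ler_wpM2l ?L2norm_ge0// Kprim_norm_le.
Qed.

End IteratedWirtinger.

Lemma width_bound_freq r n : (0 < r)%N -> (r <= n)%N ->
  width_bound a b r n ((freq (n - r).+1 ^+ r)^-1).
Proof.
move=> r0 rn; set m := (n - r).+1.
(* The indices from r to n - 1 carry the frequencies 1 to n - r = m - 1. *)
pose f (i : 'I_n) := if (i < r)%N then pmon i else trig (i - r).+1 (~~ odd r).
have cf i : continuous (f i).
  rewrite /f; case: ifP => _; first exact: continuous_pmon.
  by have [] := C1_trig a b (i - r).+1 (~~ odd r).
have lf i : L2 (f i) by exact: L2_continuous.
have [e [one fe /(_ cf) ce]] := exists_orthonormal ab lf.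
exists e => // u g lu lg /(is_primP r lu lg)[c uc].
(* The continuous representative of u. With the continuous basis [e] it makes y continuous, so that
   its primitives are [C1] and Wirtinger's inequality applies to them. *)
set U := Kprim r g + _ in uc.
have cU : continuous U.
  move=> x; apply: continuousD; first exact: continuous_Kprim.
  by apply: continuous_lincomb => j; exact: continuous_pmon.
have lU : L2 U by exact: L2_continuous.
have [le _] := one.
rewrite (eq_proj one lu lU uc); pose y := U - proj e U.
have cy : continuous y.
  by move=> x; apply: continuousB; [exact: cU|exact: continuous_lincomb].
have ly : L2 y by exact: L2_continuous.
have -> : L2norm (u - proj e U) = L2norm y.
  apply: eq_L2norm => //; first by apply: L2B => //; exact: L2_proj.
  by apply: (ae_imply _ uc) => x h _; rewrite -[RHS]/(U x - proj e U x) -h.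
have ye i : ip y (e i) = 0 by exact: ip_projB.
have yf i : ip y (f i) = 0 by apply: (ip_span0 one).
have yp j : (j < r)%N -> ip y (pmon j) = 0.
  move=> jr; have jn := leq_trans jr rn.
  by have := yf (Ordinal jn); rewrite /f /= jr.
have yt k : (0 < k < m)%N -> ip y (trig k (~~ odd r)) = 0.
  move=> /andP[k0 km]; have kn : (r + k.-1 < n)%N by move: km; rewrite /m; lia.
  have := yf (Ordinal kn); rewrite /f /= ltnNge leq_addr/=.
  by rewrite addKn prednK.
(* y is orthogonal to its projection part and to the polynomial part of U, so only K^r g remains. *)
have yy : ip y y = ip (Kprim r g) y.
  rewrite {1}/y ipBl//; last exact: L2_proj.
  rewrite [ip (proj e U) y]ipC ip_sumr// [X in _ - X]big1 ?subr0; last first.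
    by move=> i _; rewrite ye mulr0.
  have ls := L2_sum c (fun j => L2_pmon a b (nat_of_ord j)).
  rewrite ipDl//; last exact: Kprim_L2.
  rewrite [X in _ + X]ipC ip_sumr//; last by move=> j; exact: L2_pmon.
  by rewrite big1 ?addr0// => j _; rewrite yp ?mulr0.
have := ip_Kprim_le (isT : (0 < m)%N) cy yp yt lg.
rewrite -yy ger0_norm ?ip_ge0// -L2norm_sqr// => H.
have fm : 0 < freq m ^+ r by rewrite exprn_gt0// -(freq0 a b) freq_lt.
have [->|yn0] := eqVneq (L2norm y) 0.
  by rewrite mulr_ge0 ?L2norm_ge0// invr_ge0 ltW.
have y0 : 0 < L2norm y by rewrite lt_neqAle eq_sym yn0 L2norm_ge0.
rewrite mulrC ler_pdivlMr//.
by rewrite -(ler_pM2r y0) mulrAC -expr2 mulrC.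
Qed.

End UpperBound.

(** * Compactness of Hölder families *)

(** A cluster point exists by compactness of [-B, B], and along an ultrafilter a cluster point is a
    limit. One ultrafilter serves all points x at once, in place of a diagonal extraction. *)
Lemma ultra_bounded_cvg {R : realType} (U : set_system nat) (s : nat -> R) (B : R) :
  UltraFilter U -> (forall k, `|s k| <= B) ->
  exists l : R, forall e : R, 0 < e -> \forall k \near U, `|s k - l| < e.
Proof.
move=> uU sB; have pU : ProperFilter U by exact: ultra_proper.
have UB : (s @ U) `[- B, B]%classic.
  apply: (@filterS _ U _ setT); last exact: filterT.
  by move=> k _; rewrite /= in_itv/= -ler_norml.
have [l [_ cl]] := @segment_compact R (- B) B (s @ U) _ UB.
exists l => e e0.
have [//|nU] := in_ultra_setVsetC [set k | `|s k - l| < e] uU.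
have sU : (s @ U) (s @` ~` [set k | `|s k - l| < e]).
  by apply: (@filterS _ U _ _ _ _ nU) => k nk; exists k.
have [x [[k nk <-]]] := cl _ (ball l e) sU (nbhsx_ballx l e e0).
by rewrite /ball/= distrC.
Qed.

(** This retraction of the line onto [a, b] serves to extend the limit functions to the whole line
    with the same Hölder bound. *)
Lemma clamp_lipschitz {R : realType} (a b x y : R) : a <= b ->
  `|Num.max a (Num.min x b) - Num.max a (Num.min y b)| <= `|x - y|.
Proof.
move=> ab.
have clP (z : R) : [\/ a <= z <= b /\ Num.max a (Num.min z b) = z,
    z <= a /\ Num.max a (Num.min z b) = a | b <= z /\ Num.max a (Num.min z b) = b].
  have [az|/ltW za] := leP a z; last first.
    by apply: Or32; rewrite min_l ?max_l// (le_trans za).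
  have [zb|/ltW bz] := leP z b; first by apply: Or31; rewrite max_r.
  by apply: Or33; rewrite max_r.
have h1 := ler_norm (x - y).
have h2 : y - x <= `|x - y| by rewrite distrC ler_norm.
rewrite ler_norml.
by case: (clP x) => [[xab ->]|[xa ->]|[xa ->]];
  case: (clP y) => [[yab ->]|[ya ->]|[ya ->]]; apply/andP; split; lra.
Qed.

Section Compactness.
Context {R : realType} (a b : R) (ab : a < b).
Implicit Types (f g h u v z : R -> R) (B e : R).
Local Notation L2 := (L2 a b).
Local Notation ip := (ip a b).
Local Notation prim := (prim a b).
Local Notation L2norm := (L2norm a b).
Local Notation Kprim := (Kprim a b).

Lemma L2norm_bounded f e : L2 f -> 0 <= e -> (forall x, a < x < b -> `|f x| <= e) ->
  L2norm f <= e * Num.sqrt (b - a).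
Proof.
move=> lf e0 fe.
rewrite -(ler_pXn2r (n := 2))// ?nnegrE ?mulr_ge0 ?L2norm_ge0 ?sqrtr_ge0//.
rewrite L2norm_sqr// exprMn sqr_sqrtr ?subr_ge0 ?(ltW ab)// -(ip_cst1 ab).
have lc := L2_cst a b (e ^+ 2); have l1 := L2_cst a b 1.
have f2e x : a < x < b -> f x * f x <= e ^+ 2.
  move=> /fe fx; rewrite -expr2 -real_normK ?num_real//.
  by rewrite ler_pXn2r// nnegrE.
have -> : e ^+ 2 * ip (cst 1) (cst 1) = ip (cst (e ^+ 2)) (cst 1).
  have -> : cst (e ^+ 2) = e ^+ 2 *: cst 1 :> (R -> R).
    by apply/funext => t; rewrite -[RHS]/(e ^+ 2 * 1) mulr1.
  by rewrite ipZl.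
have -> : ip f f = ip (f * f) (cst 1) by apply: eq_Rintegral => x _; rewrite mulr1.
have mf := L2_measurable lf.
have lff : L2 (f * f).
  apply: (@L2_bounded _ _ _ _ (e ^+ 2)); first exact: measurable_funM.
  by move=> x xab; rewrite ger0_norm ?f2e// -[(f * f) x]/(f x * f x) -expr2 sqr_ge0.
by apply: ip_le_itv => // x xab; rewrite !mulr1; exact: f2e.
Qed.

Lemma normr_prim_le f x : L2 f -> x <= b -> `|prim f x| <= L2norm f * Num.sqrt (b - a).
Proof.
move=> lf xb; have [xa|ax] := leP x a.
  by rewrite (prim_left lf xa) normr0 mulr_ge0 ?L2norm_ge0 ?sqrtr_ge0.
have := prim_holder lf (ltW ax); rewrite (prim_left lf (lexx a)) subr0 => /le_trans; apply.
by rewrite ler_wpM2l ?L2norm_ge0// ler_wsqrtr// lerB.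
Qed.

Lemma L2norm_prim_le f : L2 f -> L2norm (prim f) <= L2norm f * (b - a).
Proof.
move=> lf; have -> : L2norm f * (b - a) = L2norm f * Num.sqrt (b - a) * Num.sqrt (b - a).
  by rewrite -mulrA -expr2 sqr_sqrtr// subr_ge0 ltW.
apply: L2norm_bounded; first exact: L2_prim.
  by rewrite mulr_ge0 ?L2norm_ge0 ?sqrtr_ge0.
by move=> x /andP[_ xb]; apply: normr_prim_le => //; exact: ltW.
Qed.

Lemma L2norm_Kprim_le r f : L2 f -> L2norm (Kprim r f) <= L2norm f * (b - a) ^+ r.
Proof.
move=> lf; elim: r => [|r IH]; first by rewrite expr0 mulr1.
apply: (le_trans (L2norm_prim_le (Kprim_L2 r lf))).
by rewrite exprSr mulrA ler_wpM2r// subr_ge0 ltW.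
Qed.

(** Arzelà-Ascoli: the pointwise limit along an ultrafilter inherits the Hölder bound, and closeness
    at finitely many grid points then gives uniform closeness. The index k is common to all i. *)
Lemma holder_subseq N (F : 'I_N -> nat -> R -> R) B :
  0 <= B -> (forall i k, continuous (F i k)) ->
  (forall i k x, a <= x <= b -> `|F i k x| <= B) ->
  (forall i k x y, a <= x <= b -> a <= y <= b ->
    `|F i k x - F i k y| <= B * Num.sqrt `|x - y|) ->
  exists h : 'I_N -> R -> R, (forall i, L2 (h i)) /\
    forall e (k0 : nat), 0 < e -> exists2 k, (k0 <= k)%N &
      forall i, L2norm (h i - F i k) <= e.
Proof.
move=> B0 cF FB Fh.
have [U [uU Uoo]] := ultraFilterLemma eventually_filter.
have pU : ProperFilter U by exact: ultra_proper.
have lim i x : exists l, a <= x <= b -> forall e, 0 < e -> \forall k \near U, `|F i k x - l| < e.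
  have [xab|nx] := boolP (a <= x <= b); last by exists 0.
  have [l hl] := @ultra_bounded_cvg R U (fun k => F i k x) B uU (fun k => FB i k x xab).
  by exists l.
have /choice[h0 hh0] : forall i, exists h, forall x, a <= x <= b ->
    forall e, 0 < e -> \forall k \near U, `|F i k x - h x| < e.
  by move=> i; have /choice[h hh] := lim i; exists h.
pose cl x := Num.max a (Num.min x b).
have clab x : a <= cl x <= b by rewrite /cl le_max lexx/= ge_max (ltW ab) ge_min lexx orbT.
have clE x : a <= x <= b -> cl x = x.
  by move=> /andP[ax xb]; rewrite /cl min_l// max_r.
have cl_lip (x y : R) : `|cl x - cl y| <= `|x - y| by exact/clamp_lipschitz/ltW.
have h0h i x y : a <= x <= b -> a <= y <= b -> `|h0 i x - h0 i y| <= B * Num.sqrt `|x - y|.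
  move=> xab yab; apply/ler_addgt0Pr => e e0.
  have e2 : 0 < e / 2 by rewrite divr_gt0.
  have [k [kx ky]] := filter_ex (filterI (hh0 i x xab _ e2) (hh0 i y yab _ e2)).
  have := Fh i k x y xab yab; move: kx ky => /=.
  by rewrite !ltr_norml !ler_norml; lra.
pose h i x := h0 i (cl x).
have ch i : continuous (h i).
  apply: (@holder_continuous _ _ B) => x y; apply: (le_trans (h0h i _ _ (clab x) (clab y))).
  by rewrite ler_wpM2l// ler_wsqrtr.
have lh i : L2 (h i) by exact: L2_continuous.
have lF i k : L2 (F i k) by exact: L2_continuous.
exists h; split => // e k0 e0.
have ba : 0 < b - a by rewrite subr_gt0.
have L0 : 0 < Num.sqrt (b - a) by rewrite sqrtr_gt0 subr_gt0.
(* The square root converts a uniform bound into a norm bound; the three parts pay for the variation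
   of h, the variation of F and the gap at a grid point. *)
pose d := e / Num.sqrt (b - a) / 3.
have d0 : 0 < d by rewrite !divr_gt0.
have [M M0 BM] : exists2 M : nat, (0 < M)%N & B * Num.sqrt ((b - a) / M%:R) <= d.
  have x0 : 0 <= B ^+ 2 * (b - a) / d ^+ 2.
    by rewrite divr_ge0 ?sqr_ge0// mulr_ge0 ?sqr_ge0// ltW.
  have xM := archi_boundP x0; set M := Num.bound _ in xM.
  have M0 : 0 < M%:R :> R by exact: le_lt_trans xM.
  exists M; first by move: M0; rewrite ltr0n.
  rewrite -(ler_pXn2r (n := 2))// ?nnegrE ?(mulr_ge0 B0) ?sqrtr_ge0 ?(ltW d0)//.
  rewrite exprMn sqr_sqrtr ?divr_ge0 ?(ltW M0) ?(ltW ba)// mulrA ler_pdivrMr//.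
  by rewrite [leRHS]mulrC -ler_pdivrMr ?exprn_gt0// ltW.
have M0' : 0 < M%:R :> R by rewrite ltr0n.
have q0 : 0 < (b - a) / M%:R by rewrite divr_gt0.
pose node (j : 'I_M.+1) := a + j%:R * ((b - a) / M%:R).
have nab j : a <= node j <= b.
  have h1 : 0 <= j%:R * ((b - a) / M%:R) by rewrite mulr_ge0// ltW.
  have h2 : j%:R * ((b - a) / M%:R) <= b - a.
    by rewrite mulrCA ler_piMr ?(ltW ba)// ler_pdivrMr// mul1r ler_nat -ltnS.
  by rewrite /node; apply/andP; split; lra.
have near_nodes : \forall k \near U, forall i j, `|F i k (node j) - h0 i (node j)| < d.
  by apply: filter_forall => i; apply: filter_forall => j; apply: hh0.
have near_k0 : \forall k \near U, (k0 <= k)%N.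
  by apply: Uoo; exact: nbhs_infty_ge.
have [k [kn kk0]] := filter_ex (filterI near_nodes near_k0).
exists k => // i.
have -> : e = (d * 3) * Num.sqrt (b - a) by rewrite /d !divfK ?gt_eqF.
apply: L2norm_bounded; [exact: L2B|by rewrite mulr_ge0// ltW|] => x xab'.
have xab : a <= x <= b by move: xab' => /andP[/ltW-> /ltW->].
have [j xj] : exists j, `|x - node j| <= (b - a) / M%:R.
  pose t := (x - a) / ((b - a) / M%:R).
  have /andP[ax xb] := xab.
  have t0 : 0 <= t by rewrite divr_ge0 ?(ltW q0)// subr_ge0.
  have /andP[tj jt] := truncn_itv t0.
  have jM : (Num.truncn t < M.+1)%N.
    rewrite ltnS -(ler_nat R) (le_trans tj)// /t ler_pdivrMr// mulrC divfK ?gt_eqF//.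
    by rewrite lerD2r.
  exists (Ordinal jM); rewrite /node /=.
  have xE : x = a + t * ((b - a) / M%:R) by rewrite divfK ?gt_eqF// addrC subrK.
  have tj' : (Num.truncn t)%:R * ((b - a) / M%:R) <= t * ((b - a) / M%:R).
    by rewrite ler_pM2r.
  have jt' : t * ((b - a) / M%:R) < ((Num.truncn t)%:R + 1) * ((b - a) / M%:R).
    by rewrite ltr_pM2r// natr1.
  by rewrite {1}xE ler_norml; lra.
have BS : B * Num.sqrt `|x - node j| <= d.
  by apply: le_trans BM; rewrite ler_wpM2l// ler_wsqrtr.
rewrite -[(h i - F i k) x]/(h0 i (cl x) - F i k x) clE//.
have := h0h i x (node j) xab (nab j).
have := Fh i k x (node j) xab (nab j).
have := kn i j; rewrite !ltr_norml !ler_norml; lra.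
Qed.

End Compactness.

(** * Extremal spaces made of polynomials and r-fold primitives *)

Section Attained.
Context {R : realType} (a b : R) (ab : a < b).
Implicit Types (f g h u v z : R -> R) (C e : R) (r n : nat).
Local Notation mu := (leb_itv a b).
Local Notation L2 := (L2 a b).
Local Notation ip := (ip a b).
Local Notation prim := (prim a b).
Local Notation L2norm := (L2norm a b).
Local Notation proj := (proj a b).
Local Notation pmon := (pmon a b).
Local Notation Kprim := (Kprim a b).

(** The primitive of v^2 is identically zero, and its derivative at x is v(x)^2. *)
Lemma continuous_ae0 v x : continuous v -> v = 0 %[ae mu] -> a < x < b -> v x = 0.
Proof.
move=> cv v0 xab; have lv := L2_continuous a b cv.
have cvv : continuous (v * v) by move=> y; apply: continuousM; exact: cv.
have lvv := L2_continuous a b cvv.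
have vv0 : v * v = 0 %[ae mu].
  by apply: (ae_imply _ v0) => y h _; rewrite -[LHS]/(v y * v y) h// mulr0.
have p0 : prim (v * v) = 0.
  apply/funext => y; rewrite -[RHS](ip0l a b (below y)).
  apply: eq_ip => //; [by have [] := L2_submod_closed a b|exact: L2_below..|].
  exact: ae_itv.
have d1 : is_derive x 1 (prim (v * v)) ((v * v) x).
  by apply: is_derive_prim => //; exact: cvv.
have d2 : is_derive x 1 (prim (v * v)) 0 by rewrite p0; exact: is_derive_cst.
have /eqP : v x * v x = 0.
  by rewrite -[LHS]/((v * v) x) -(@derive_val _ _ _ _ _ _ _ d1) (@derive_val _ _ _ _ _ _ _ d2).
by rewrite mulf_eq0 orbb => /eqP.
Qed.

(** The sum is its constant term plus a primitive, and that primitive vanishes at a, which kills the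
    constant term. The primitive is then zero, hence so is the function under it, and the induction
    goes on. *)
Lemma pmon_free r (c : 'I_r -> R) : \sum_j c j *: pmon j = 0 %[ae mu] ->
  forall j, c j = 0.
Proof.
elim: r c => [|r IH] c c0; first by case.
pose S := \sum_j c (lift ord0 j) *: pmon j.
have lS : L2 S by apply: L2_sum => j; exact: L2_pmon.
have SE : \sum_j c j *: pmon j = prim S + cst (c ord0).
  rewrite big_ord_recl prim_sum; last by move=> j; exact: L2_pmon.
  rewrite addrC; congr (_ + _).
  by apply/funext => x; rewrite -[LHS]/(c ord0 * 1) mulr1.
have cpS := prim_continuous lS.
have z x : a < x < b -> prim S x = - c ord0.
  move=> xab; apply/eqP; rewrite -addr_eq0; apply/eqP.
  rewrite -[LHS]/((prim S + cst (c ord0)) x) -SE.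
  apply: continuous_ae0 => //; apply: continuous_lincomb => j.
  exact: continuous_pmon.
have h1 : prim S y @[y --> a^'+] --> - c ord0.
  apply: cvg_near_cst; near=> y; apply: z; apply/andP; split; near: y.
    exact: nbhs_right_gt.
  exact: nbhs_right_lt.
have h2 : prim S y @[y --> a^'+] --> prim S a.
  by apply: cvg_at_right_filter; exact: cpS.
have c00 : c ord0 = 0.
  apply/eqP; rewrite -oppr_eq0 (cvg_unique (@Rhausdorff R) h1 h2).
  by rewrite prim_left.
have h3 : prim S y @[y --> b^'-] --> (0 : R).
  apply: cvg_near_cst; near=> y; rewrite z ?c00 ?oppr0//.
  by apply/andP; split; near: y; [exact: nbhs_left_gt|exact: nbhs_left_lt].
have h4 : prim S y @[y --> b^'-] --> prim S b.
  by apply: cvg_at_left_filter; exact: cpS.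
have S0 : S = 0 %[ae mu].
  apply: prim_eq0_ae => // x; have [xa|ax] := leP x a; first exact: prim_left.
  have [xb|bx] := ltP x b; first by rewrite z ?c00 ?oppr0// ax.
  by rewrite (prim_right lS bx) -(prim_right lS (lexx b)) (cvg_unique (@Rhausdorff R) h3 h4).
move=> j; case: (unliftP ord0 j) => [i ->|->//].
exact: (IH (fun i => c (lift ord0 i))).
Unshelve. all: by end_near. Qed.

Lemma Kprim_lincomb r n (c : 'I_n -> R) (e : 'I_n -> R -> R) : (forall i, L2 (e i)) ->
  Kprim r (\sum_i c i *: e i) = \sum_i c i *: Kprim r (e i).
Proof.
move=> le; elim: r => //= r IH; rewrite -[LHS]/(prim (Kprim r _)) IH prim_sum//.
by move=> i; exact: Kprim_L2.
Qed.

Lemma KprimB r f g : L2 f -> L2 g -> Kprim r (f - g) = Kprim r f - Kprim r g.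
Proof.
move=> lf lg; elim: r => //= r IH; rewrite -[LHS]/(prim (Kprim r _)) IH.
by apply/funext => x; apply: primB; exact: Kprim_L2.
Qed.

Lemma is_prim_Kprim r g (c : 'I_r -> R) : L2 g ->
  is_prim a b r (Kprim r g + \sum_j c j *: pmon j) g.
Proof.
move=> lg; apply/is_primP => //; last by exists c; exact: ae_itv.
by apply: L2D; [exact: Kprim_L2|apply: L2_sum => j; exact: L2_pmon].
Qed.

(* If Y is the orthogonal complement of the polynomials in the extremal space,
   then c is also attained by the polynomials plus K^r F, where F = K^r Y: for
   g orthogonal to F, K^r g is orthogonal to Y. The new space is relatively
   compact, because it is spanned by r-fold primitives. *)
Lemma width_bound_Kprim r n C : (0 < r)%N -> (r <= n)%N -> width_bound a b r n C ->
  exists2 phi : 'I_(n - r) -> R -> R, orthonormal a b phi &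
    forall g, L2 g -> exists c : 'I_r -> R,
      L2norm (Kprim r g - \sum_i ip g (phi i) *: Kprim r (phi i) -
              \sum_j c j *: pmon j) <= C * L2norm g.
Proof.
(* Positivity, drawn from the lower bound, allows the final comparison of |g'| with |g| to be
   multiplied by C. *)
move=> r0 rn wC; have C0 : 0 < C.
  have := width_bound_ge ab r0 wC; have := exprn_ge0 r (freq_ge0 ab n) => f0.
  move=> C1; rewrite ltNge; apply/negP => Cn.
  by have := mulr_le0_ge0 Cn f0; lra.
have [e one He] := wC; have [le ee] := one.
have lp (j : 'I_r) : L2 (pmon j) by exact: L2_pmon.
(* The r-th derivative of [pmon j] is 0, so its distance to the space is at most C 0: the space
   contains the polynomials. *)
have pe (j : 'I_r) : pmon j = proj e (pmon j) %[ae mu].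
  have l0 : L2 0 by have [] := L2_submod_closed a b.
  have := He (pmon j) 0 (lp j) l0.
  have -> : L2norm 0 = 0 by rewrite L2normE// ip0l sqrtr0.
  rewrite mulr0 => h; have {}h := h _.
  have lpp : L2 (pmon j - proj e (pmon j)) by apply: L2B => //; exact: L2_proj.
  have : pmon j - proj e (pmon j) = 0 %[ae mu].
    apply: ip_eq0 => //; rewrite -L2norm_sqr//.
    have -> : L2norm (pmon j - proj e (pmon j)) = 0; last by rewrite expr0n.
    apply/eqP; rewrite eq_le L2norm_ge0 andbT; apply: h.
    have := is_prim_Kprim (fun i => (i == j)%:R) l0.
    rewrite -[X in Kprim r X](subrr (0 : R -> R)) KprimB// subrr add0r (bigD1 j)//=.
    rewrite eqxx scale1r big1 ?addr0// => i /negbTE ->; exact: scale0r.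
  by apply: ae_imply => x hx _; apply/eqP; rewrite -subr_eq0; apply/eqP; exact: hx.
pose M : 'M[R]_(r, n) := \matrix_(j, i) ip (pmon j) (e i).
have projE (al : 'rV_r) i : ip (\sum_j al 0 j *: pmon j) (e i) = (al *m M) 0 i.
  by rewrite ip_suml// mxE; apply: eq_bigr => j _; rewrite mxE.
have freeM : row_free M.
  apply: inj_row_free => al alM; apply/rowP => j; rewrite mxE.
  have lal : L2 (\sum_j al 0 j *: pmon j) by exact: L2_sum.
  apply: (@pmon_free r (al 0)); apply: ip_eq0 => //.
  rewrite ip_sumr// big1// => k _.
  rewrite (ip_span0 one (lp k) lal (pe k)) ?mulr0// => i.
  by rewrite projE alM mxE.
have rM : \rank M = r by exact/eqP.
have rN : \rank (kermx M^T) = (n - r)%N by rewrite mxrank_ker mxrank_tr rM.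
(* The rows of [B] are the coordinates, in the basis e, of a basis of the orthogonal complement Y of
   the polynomials. *)
have [B BN] : exists B : 'M[R]_(n - r, n), (B :=: kermx M^T)%MS.
  by rewrite -rN; exists (row_base (kermx M^T)); exact: eq_row_base.
have BM : B *m M^T = 0 by apply/sub_kermxP; rewrite BN.
(* The complement of the complement is the original space, by comparison of ranks. *)
have rB (w : 'rV_n) : B *m w^T = 0 -> (w <= M)%MS.
  move=> Bw; have wB : (w <= kermx B^T)%MS.
    by apply/sub_kermxP; rewrite -[w]trmxK -trmx_mul Bw trmx0.
  apply: (submx_trans wB).
  have MB : (M <= kermx B^T)%MS.
    by apply/sub_kermxP; rewrite -[M]trmxK -trmx_mul BM trmx0.
  rewrite -(geq_leqif (mxrank_leqif_sup MB)) mxrank_ker mxrank_tr BN rN rM.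
  by rewrite subKn.
pose y i := \sum_k B i k *: e k.
have ly i : L2 (y i) by exact: L2_sum.
have yp i j : (j < r)%N -> ip (y i) (pmon j) = 0.
  move=> jr; rewrite ip_suml//; last exact: L2_pmon.
  have := congr1 (fun A : 'M[R]_(n - r, r) => A i (Ordinal jr)) BM; rewrite !mxE => s0; rewrite -[RHS]s0.
  by apply: eq_bigr => k _; rewrite !mxE ipC.
have lK i : L2 (Kprim r (y i)) by exact: Kprim_L2.
have [phi [onphi yphi _]] := exists_orthonormal ab lK.
exists phi => // g lg; have [lphi _] := onphi.
pose g' := g - proj phi g.
have lg' : L2 g' by apply: L2B => //; exact: L2_proj.
pose u := Kprim r g'.
have lu : L2 u by exact: Kprim_L2.
have uy i : ip u (y i) = 0.
  rewrite /u (ip_Kprim (ly i) (yp i) lg' (leqnn r)) subnn -[Kprim 0 g']/g'.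
  rewrite (ip_span0 onphi (lK i) lg' (yphi i)) ?mulr0// => k.
  exact: ip_projB.
(* Since u is orthogonal to Y, its projection on the space is a polynomial, whose coefficients are
   the c sought. *)
have : (\row_i ip u (e i) <= M)%MS.
  apply: rB; apply/matrixP => i j; rewrite mxE [RHS]mxE -[RHS](uy i) ip_sumr//.
  by apply: eq_bigr => k _; rewrite !mxE.
move=> /submxP[al alE].
exists (al 0).
have KE : Kprim r g - \sum_i ip g (phi i) *: Kprim r (phi i) = u.
  by rewrite /u KprimB ?Kprim_lincomb//; exact: L2_proj.
rewrite KE.
have lal : L2 (\sum_j al 0 j *: pmon j) by exact: L2_sum.
have pu : proj e u = \sum_j al 0 j *: pmon j %[ae mu].
  have -> : proj e u = proj e (\sum_j al 0 j *: pmon j).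
    apply: eq_bigr => i _; congr (_ *: _); rewrite projE -alE mxE//.
  by apply: (ae_imply _ (span_lincomb (al 0) one lp pe)) => x h _; rewrite h.
have -> : L2norm (u - \sum_j al 0 j *: pmon j) = L2norm (u - proj e u).
  apply: eq_L2norm; [exact: L2B|by apply: L2B => //; exact: L2_proj|].
  apply: (ae_imply _ pu) => x h _; rewrite -[RHS]/(u x - proj e u x) h//.
apply: (@le_trans _ _ (C * L2norm g')).
  apply: He => //; have := @is_prim_Kprim r g' (fun=> 0) lg'.
  by rewrite big1 ?addr0// => j _; rewrite scale0r.
rewrite ler_pM2l//; have := proj_min onphi (fun=> 0) lg.
by rewrite big1 ?subr0// => j _; rewrite scale0r.
Qed.

End Attained.

(** * The set of admissible constants is closed *)

Section Closedness.
Context {R : realType} (a b : R) (ab : a < b).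
Implicit Types (f g h u v z : R -> R) (C e : R) (r n : nat).
Local Notation mu := (leb_itv a b).
Local Notation L2 := (L2 a b).
Local Notation ip := (ip a b).
Local Notation L2norm := (L2norm a b).
Local Notation proj := (proj a b).
Local Notation pmon := (pmon a b).
Local Notation Kprim := (Kprim a b).

Lemma L2norm_lincomb_le n (c : 'I_n -> R) (e : 'I_n -> R -> R) :
  (forall i, L2 (e i)) ->
  L2norm (\sum_i c i *: e i) <= \sum_i `|c i| * L2norm (e i).
Proof.
move=> le; suff [] : L2 (\sum_i c i *: e i) /\
  L2norm (\sum_i c i *: e i) <= \sum_i `|c i| * L2norm (e i) by [].
elim/big_rec2: _ => [|i x f _ [lf fx]].
  have l0 : L2 0 by have [] := L2_submod_closed a b.
  by rewrite L2normE// ip0l sqrtr0.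
have li := L2Z (c i) (le i); split; first exact: L2D.
by apply: (le_trans (L2norm_triangle li lf)); rewrite L2norm_scale// lerD2l.
Qed.

(** For the constants C + 1/(k+1), the r-fold primitives of the orthonormal [phi k] are uniformly
    bounded and Hölder, hence approach limits h along suitable k. The coefficients need no limit:
    for each g, those found at a good k are reused with h in place of the primitives. *)
Lemma width_bound_closed r n C : (0 < r)%N -> (r <= n)%N ->
  (forall e, 0 < e -> width_bound a b r n (C + e)) -> width_bound a b r n C.
Proof.
(* With r > 0 there is an outermost primitive, which supplies the Hölder estimate. *)
case: r => // r _ rn wC; set N := (n - r.+1)%N.
have ba : 0 < b - a by rewrite subr_gt0.
have /choice[phi Hphi] : forall k : nat, exists phi : 'I_N -> R -> R,
    orthonormal a b phi /\ forall g, L2 g -> exists c : 'I_r.+1 -> R,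
      L2norm (Kprim r.+1 g - \sum_i ip g (phi i) *: Kprim r.+1 (phi i) -
              \sum_j c j *: pmon j) <= (C + k.+1%:R^-1) * L2norm g.
  move=> k; have e0 : 0 < k.+1%:R^-1 :> R by rewrite invr_gt0.
  have [phi onphi phiE] := width_bound_Kprim ab (ltn0Sn r) rn (wC _ e0).
  by exists phi.
have lphi k i : L2 (phi k i) by have [[] ] := Hphi k.
pose F i k := Kprim r.+1 (phi k i).
have lF i k : L2 (F i k) by exact: Kprim_L2.
have lF' i k : L2 (Kprim r (phi k i)) by exact: Kprim_L2.
have nF' i k : L2norm (Kprim r (phi k i)) <= (b - a) ^+ r.
  apply: (le_trans (L2norm_Kprim_le ab r (lphi k i))).
  by rewrite (orthonormal_norm i (Hphi k).1) mul1r.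
pose B := (b - a) ^+ r * (1 + Num.sqrt (b - a)).
have p0 : 0 <= (b - a) ^+ r by rewrite exprn_ge0// ltW.
have sB : (b - a) ^+ r * Num.sqrt (b - a) <= B by rewrite ler_wpM2l// lerDr.
have oB : (b - a) ^+ r <= B by rewrite ler_peMr// lerDl sqrtr_ge0.
have [h [lh hF]] : exists h : 'I_N -> R -> R, (forall i, L2 (h i)) /\
    forall e (k0 : nat), 0 < e -> exists2 k, (k0 <= k)%N &
      forall i, L2norm (h i - F i k) <= e.
  apply: (@holder_subseq _ _ _ ab N F B).
  - by apply: le_trans oB.
  - by move=> i k; apply: continuous_Kprim.
  - move=> i k x /andP[_ xb]; apply: le_trans sB.
    rewrite -[F i k x]/(prim a b (Kprim r (phi k i)) x).
    by apply: (le_trans (normr_prim_le (lF' i k) xb)); rewrite ler_wpM2r ?sqrtr_ge0.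
  - move=> i k x y _ _.
    rewrite -[F i k _]/(prim a b (Kprim r (phi k i)) x) -[F i k _]/(prim a b (Kprim r (phi k i)) y).
    apply: (le_trans (prim_holder_abs x y (lF' i k))).
    by rewrite ler_wpM2r ?sqrtr_ge0// (le_trans (nF' i k)).
suff : width_bound a b r.+1 (r.+1 + N) C by rewrite subnKC.
(* The limits h may be linearly dependent; [exists_orthonormal] allows this and keeps the dimension
   n. *)
pose f (j : 'I_(r.+1 + N)) := match fintype.split j with inl j => pmon j | inr i => h i end.
have fl j : f (lshift N j) = pmon j by rewrite /f -[lshift _ _]/(unsplit (inl j)) unsplitK.
have fr i : f (rshift r.+1 i) = h i by rewrite /f -[rshift _ _]/(unsplit (inr i)) unsplitK.
have lp j : L2 (pmon j) by exact: L2_pmon.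
have lf j : L2 (f j) by rewrite /f; case: fintype.split.
have [e [one fe _]] := exists_orthonormal ab lf.
exists e => // u g lu lg /(is_primP r.+1 lu lg)[c uc].
apply/ler_addgt0Pr => eps eps0.
have g0 := L2norm_ge0 a b g.
(* The total error is (N + 1) d |g|: one share from the constant C + d and N shares from replacing
   the primitives by h. The + 1 covers |g| = 0. *)
pose d := eps / (N.+1%:R * (L2norm g + 1)).
have d0 : 0 < d by rewrite divr_gt0// mulr_gt0// ltr_wpDl.
have [k0 hk0] : exists k0 : nat, forall k, (k0 <= k)%N -> k.+1%:R^-1 <= d.
  exists (Num.bound d^-1) => k kk; have d1 : 0 <= d^-1 by rewrite invr_ge0 ltW.
  rewrite -[d]invrK lef_pV2 ?posrE ?invr_gt0//.
  apply: (le_trans (ltW (archi_boundP d1))); rewrite ler_nat.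
  exact: leq_trans kk _.
have [k kk hFk] := hF d k0 d0.
have [c' Hc'] := (Hphi k).2 g lg.
pose gam i := ip g (phi k i).
pose T := \sum_j (c j + c' j) *: pmon j + \sum_i gam i *: h i.
pose S1 := Kprim r.+1 g - \sum_i gam i *: F i k - \sum_j c' j *: pmon j.
pose S2 := \sum_i (- gam i) *: (h i - F i k).
have lS0 := L2_sum gam (fun i => lF i k).
have lS1 : L2 S1.
  apply: L2B; last by apply: L2_sum => j.
  by apply: L2B => //; exact: Kprim_L2.
have lhF i : L2 (h i - F i k) by exact: L2B.
have lS2 : L2 S2 by exact: L2_sum.
have lT : L2 T by apply: L2D; apply: L2_sum.
pose cc (j : 'I_(r.+1 + N)) := match fintype.split j with inl j => c j + c' j | inr i => gam i end.
have TE : T = \sum_j cc j *: f j.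
  rewrite big_split_ord /=; congr (_ + _); apply: eq_bigr => j _.
    by rewrite fl /cc -[lshift _ _]/(unsplit (inl j)) unsplitK.
  by rewrite fr /cc -[rshift _ _]/(unsplit (inr j)) unsplitK.
have Tp : T = proj e T %[ae mu] by rewrite TE; exact: span_lincomb.
apply: (le_trans (proj_min_span one lu lT Tp)).
have -> : L2norm (u - T) = L2norm (S1 + S2).
  apply: eq_L2norm; [exact: L2B|exact: L2D|].
  apply: (ae_imply _ uc) => x ux _.
  rewrite -[LHS]/(u x - (\sum_j (c j + c' j) *: pmon j + \sum_i gam i *: h i) x) ux//.
  rewrite -[RHS]/(Kprim r.+1 g x - (\sum_i gam i *: F i k) x -
    (\sum_j c' j *: pmon j) x + (\sum_i (- gam i) *: (h i - F i k)) x).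
  rewrite -[(_ + _) x]/(Kprim r.+1 g x + (\sum_j c j *: pmon j) x).
  rewrite -[((\sum_j _) + _) x]/((\sum_j (c j + c' j) *: pmon j) x + (\sum_i gam i *: h i) x).
  rewrite !lincombE.
  under [\sum_j (c j + c' j) * _]eq_bigr do rewrite mulrDl.
  rewrite big_split /=.
  have -> : \sum_i - gam i * (h i - F i k) x =
      \sum_i gam i * F i k x - \sum_i gam i * h i x.
    rewrite -sumrB; apply: eq_bigr => i _.
    by rewrite -[(h i - F i k) x]/(h i x - F i k x); ring.
  ring.
apply: (le_trans (L2norm_triangle lS1 lS2)).
have S2le : L2norm S2 <= N%:R * (L2norm g * d).
  apply: (le_trans (L2norm_lincomb_le _ lhF)).
  apply: (@le_trans _ _ (\sum_(i < N) L2norm g * d)); last first.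
    by rewrite sumr_const card_ord mulr_natl.
  apply: ler_sum => i _; apply: ler_pM => //; first exact: L2norm_ge0.
  rewrite normrN (le_trans (normr_ip_le lg (lphi k i)))//.
  by rewrite (orthonormal_norm i (Hphi k).1) mulr1.
have kd := hk0 k kk.
apply: (@le_trans _ _ ((C + d) * L2norm g + N%:R * (L2norm g * d))).
  apply: lerD => //; apply: (le_trans Hc').
  by rewrite ler_wpM2r// lerD2l.
have -> : (C + d) * L2norm g + N%:R * (L2norm g * d) =
    C * L2norm g + N.+1%:R * (d * L2norm g) by rewrite -natr1; ring.
rewrite lerD2l; apply: (@le_trans _ _ (N.+1%:R * (d * (L2norm g + 1)))).
  by rewrite ler_wpM2l// ler_wpM2l ?(ltW d0)// lerDl.
rewrite mulrCA divfK// gt_eqF// mulr_gt0//.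
by rewrite ltr_wpDl.
Qed.

End Closedness.

(** * From bounds on the least constant to bounds on its power *)

Lemma powR_invX_root {R : realType} (x : R) r : 0 < x -> (0 < r)%N ->
  (x ^+ r)^-1 `^ (- r%:R^-1) = x.
Proof.
move=> x0 r0; have rn0 : r%:R != 0 :> R by rewrite pnatr_eq0 -lt0n.
by rewrite -powR_mulrn ?ltW// -powRN -powRrM mulrNN divff// powRr1 ?ltW.
Qed.

Lemma powR_neg_le {R : realType} (x y s : R) : 0 <= s -> 0 < x -> x <= y ->
  y `^ (- s) <= x `^ (- s).
Proof.
move=> s0 x0 xy; have y0 := lt_le_trans x0 xy.
by rewrite !powRN lef_pV2 ?posrE ?powR_gt0// ge0_ler_powR ?nnegrE // ltW.
Qed.

Theorem theorem1 (R : realType) (a b : R) (ab : a < b) (r : nat)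
    (r1 : (1 <= r)%N) (n : nat) (rn : (r <= n)%N) :
  exists2 d : R, is_least (width_constants a b r n) d &
    (n%:R - r%:R + 1) * pi / (b - a) <= d `^ (- (r%:R)^-1) <=
      n%:R * pi / (b - a).
Proof.
have r0 : (0 < r)%N by [].
have fn0 : 0 < freq a b n ^+ r.
  by rewrite exprn_gt0// -(freq0 a b) freq_lt// (leq_trans r0).
set m := (n - r).+1; have fm0 : 0 < freq a b m by rewrite -(freq0 a b) freq_lt.
have fn1 : 0 < freq a b n by rewrite -(freq0 a b) freq_lt// (leq_trans r0).
pose S := width_constants a b r n; pose d := inf S.
have mS : S (freq a b m ^+ r)^-1 by apply/width_boundP => //; exact: width_bound_freq.
have lbS : lbound S (freq a b n ^+ r)^-1.
  move=> C /(width_boundP ab)/(width_bound_ge ab r0) C1.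
  by rewrite -[_^-1]mul1r ler_pdivrMr.
have iS : has_inf S by split; [exists (freq a b m ^+ r)^-1|exists (freq a b n ^+ r)^-1].
have dge : (freq a b n ^+ r)^-1 <= d by apply: lb_le_inf => //; case: iS.
have dle : d <= (freq a b m ^+ r)^-1 by apply: ge_inf => //; case: iS.
have d0 : 0 < d by apply: lt_le_trans dge; rewrite invr_gt0.
exists d.
  split; last by move=> C SC; apply: ge_inf => //; case: iS.
  (* Every d + e lies above some admissible constant, hence is admissible, and closedness gives d
     itself. *)
  apply/width_boundP => //; apply: width_bound_closed => // e e0.
  have [C SC Cd] := inf_adherent e0 iS.
  by apply: width_bound_le (ltW Cd) _; exact/width_boundP.
have -> : (n%:R - r%:R + 1) * pi / (b - a) = freq a b m.
  by rewrite /freq /m -natr1 natrB.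
have rV0 : 0 <= r%:R^-1 :> R by rewrite invr_ge0.
(* The power -1/r reverses the order on positive reals, so the upper bound on d yields the left
   inequality. *)
rewrite -/(freq a b n); apply/andP; split.
  by rewrite -[leLHS](powR_invX_root fm0 r0) powR_neg_le.
by rewrite -[leRHS](powR_invX_root fn1 r0) powR_neg_le// invr_gt0.
Qed.
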